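(* Let $F$ be a field of characteristic not equal to $2$, and let $r,s,n$ be positive integers. If a sum-of-squares formula of type $[r,s,n]$ exists over $F$, then the binomial coefficient $\binom{n}{i}$ is even for every integer $i$ with $n-r<i<s$.
   Context: A sum-of-squares formula of type $[r,s,n]$ over a field $F$ is an identity $$\Bigl(\sum_{i=1}^{r}x_i^2\Bigr)\cdot\Bigl(\sum_{i=1}^{s}y_i^2\Bigr)=\sum_{i=1}^{n}z_i^2$$ in the polynomial ring $F[x_1,\ldots,x_r,y_1,\ldots,y_s]$, where each $z_i$ is a bilinear expression in the $x$'s and $y$'s, i.e. $z_i=\sum_{j,k}c^{(i)}_{jk}x_jy_k$ with coefficients $c^{(i)}_{jk}\in F$. *)

(* Defs.v *)
From HB Require Import structures.
From mathcomp Require Import all_boot all_order all_algebra.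
From mathcomp.multinomials Require Import mpoly.

Set Implicit Arguments.
Unset Strict Implicit.
Unset Printing Implicit Defensive.

Import GRing.Theory.
Local Open Scope ring_scope.

Section SumsOfSquaresFormula.

Variables (F : fieldType) (r s n : nat).

(* F[x_1, .., x_r, y_1, .., y_s] is {mpoly F[r + s]}: the first r variables
   are the x's, the last s are the y's. *)
Definition xvar (j : 'I_r) : {mpoly F[r + s]} := 'X_(lshift s j).
Definition yvar (k : 'I_s) : {mpoly F[r + s]} := 'X_(rshift r k).

Definition bilinear_expr (c : 'M[F]_(r, s)) : {mpoly F[r + s]} :=
  \sum_(j < r) \sum_(k < s) c j k *: (xvar j * yvar k).

Definition sum_of_squares_formula (z : 'I_n -> {mpoly F[r + s]}) : Prop :=
  (forall i, exists c : 'M[F]_(r, s), z i = bilinear_expr c) /\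
  (\sum_(j < r) xvar j ^+ 2) * (\sum_(k < s) yvar k ^+ 2)
    = \sum_(i < n) z i ^+ 2.

End SumsOfSquaresFormula.

(* The binomial coefficient with an integer lower index, zero when that index
   is negative. *)
Definition binz (n : nat) (i : int) : nat :=
  if i is Posz k then 'C(n, k) else 0%N.

(* Main.v *)
Require Import Defs.
From HB Require Import structures.
From mathcomp Require Import all_boot all_order all_algebra all_fingroup all_field.
From mathcomp.multinomials Require Import mpoly.
From mathcomp Require Import ring zify.
From Stdlib Require Import Classical_Prop.

Set Implicit Arguments.
Unset Strict Implicit.
Unset Printing Implicit Defensive.

Import GRing.Theory.
Local Open Scope ring_scope.

(** Suppose that a formula of type [r, s, n] exists and that 'C(n, i) is odd for
    some i with n - r < i < s. Put b = i./2 and a = n./2 - b; then 'C(a + b, b) is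
    odd as well, and a and b are at most about half of r and s.

    After adjoining a square root of -1, a sum of two squares is a hyperbolic
    plane, so that the sum of the n squares becomes the sum of a + b products
    u_l v_l, plus one square w^2 if n is odd. For the same reason, over a field K of
    rational functions in a + b + 2 variables, K^r and K^s contain a + 1 and
    b + 1 orthogonal vectors whose norms d_c and e_k are distinct variables, except
    that the last norm may have to be 1. On combinations x and y of these vectors
    the formula reads
      phi (x (x) y) = sum_l u_l (x, y) v_l (x, y),
      where phi (X) = sum_(c, k) d_c e_k X_ck^2 - w (X)^2.
    The form phi is anisotropic on all arrays X: its coefficients are distinct
    square-free monomials, and - w^2 is the square of sqrt(-1) w, with the
    coefficient 1 that no d_c e_k takes when n is odd ([anisotropic_markers]).

    Hence no nonzero x and y have u_l (x, y) = 0 for all l, over any extension where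
    phi stays anisotropic. But these are a + b bilinear equations on a product of
    projective spaces of dimensions a and b, with 'C(a + b, b) solutions when they
    are in general position. That number is odd, so there should be a solution
    over an extension made of steps of odd degree, and by Springer's theorem
    ([springer_extension]) phi stays anisotropic there. This is the contradiction.

    Two devices replace intersection theory in this last step.

    General position is obtained by perturbation. With a new variable T, replace
    u_l by T u_l + g_l and phi by T phi + sum_l g_l v_l; the new form is
    anisotropic as soon as phi is, by comparing degrees in T
    ([anisotropic_pencil]), whatever the g_l are. They can be chosen so that the
    perturbed system is nondegenerate ([generic_nondegenerate]).

    Counting is replaced by linear algebra. Written as sum_j y_j A_j x = 0 with
    j = 0, .., b and matrices A_j, the system is a multiparameter eigenvalue problem.
    In the nondegenerate case it yields commuting operators G_j on the symmetric
    tensors of degree b on K^(a + 1), characterized by G_0 = 1 and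
    sum_j A_j (G_j w) = 0, where A_j acts on one tensor factor. That they exist is a
    dimension count ([gamma_exists]); that they commute is a computation with
    alternating contractions, in the manner of Cramer's rule ([gamma_commute]).
    A common eigenvector of the G_j gives a solution (x, y): the eigenvalues form y,
    and x is a slice of the tensor ([multiparameter_eigenvector]). The space of
    tensors has dimension 'C(a + b, b), and commuting operators on a space of odd
    dimension have a common eigenvector after extensions of odd degree
    ([odd_common_eigenvector]). *)

(** * Quadratic forms and polynomial vectors *)

(** The matrix of coefficients may fail to be symmetric, so that a product of two
    linear forms enters as it stands. *)
Definition qform (R : comNzRingType) (I : finType) (B : I -> I -> R)
  (x : I -> R) : R := \sum_i \sum_j B i j * x i * x j.

Definition anisotropic (K : fieldType) (I : finType) (B : I -> I -> K) : Prop :=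
  forall x : I -> K, qform B x = 0 -> forall i, x i = 0.

Section QformBasics.
Variables (R : comNzRingType) (I : finType).
Implicit Types (B : I -> I -> R) (x : I -> R).

Lemma qformZ B c x : qform B (fun i => c * x i) = c ^+ 2 * qform B x.
Proof.
rewrite /qform mulr_sumr; apply: eq_bigr => i _; rewrite mulr_sumr.
by apply: eq_bigr => j _; ring.
Qed.

Lemma eq_qform B x y : x =1 y -> qform B x = qform B y.
Proof. by move=> e; apply: eq_bigr => i _; apply: eq_bigr => j _; rewrite !e. Qed.

Lemma rmorph_qform (S : comNzRingType) (f : {rmorphism R -> S}) B x :
  f (qform B x) = qform (fun i j => f (B i j)) (fun i => f (x i)).
Proof.
rewrite rmorph_sum; apply: eq_bigr => i _; rewrite rmorph_sum.
by apply: eq_bigr => j _; rewrite !rmorphM.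
Qed.

End QformBasics.

Lemma eq_qform_coef (R : comNzRingType) (I : finType) (B C : I -> I -> R) x :
  (forall i j, B i j = C i j) -> qform B x = qform C x.
Proof. by move=> e; apply: eq_bigr => i _; apply: eq_bigr => j _; rewrite e. Qed.

Section PolyForms.
Variables (K : fieldType) (I : finType).
Implicit Types (B : I -> I -> K) (Y : I -> {poly K}).

(** The top degree n of the entries, with the vector of their coefficients of
    degree n: the polynomial vectors below are treated like single polynomials
    through their leading vector. *)
Lemma leading_vector Y : (exists i, Y i != 0) ->
  exists n, (forall i, (size (Y i) <= n.+1)%N) /\ exists i, (Y i)`_n != 0.
Proof.
case=> i0 Yi0.
have [i _ /(_ _ isT) maxi] := @arg_maxnP _ i0 predT (fun i => size (Y i)) isT.
have : (0 < size (Y i))%N by apply: leq_trans (maxi i0); rewrite size_poly_gt0.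
case E: (size (Y i)) => [//|n] _; exists n; split=> [j|].
  by rewrite -E; apply: maxi.
by exists i; rewrite -[n]/(n.+1.-1) -E -lead_coefE lead_coef_eq0 -size_poly_eq0 E.
Qed.

Lemma size_qform_leq B Y n : (forall i, (size (Y i) <= n.+1)%N) ->
  (size (qform (fun i j => (B i j)%:P) Y) <= (n + n).+1)%N.
Proof.
move=> sY; apply: (leq_trans (size_sum _ _ _)); apply/bigmax_leqP => i _.
apply: (leq_trans (size_sum _ _ _)); apply/bigmax_leqP => j _.
rewrite -mulrA mul_polyC; apply: leq_trans (size_scale_leq _ _) _.
apply: leq_trans (size_polyMleq _ _) _.
move: (sY i) (sY j); set u := size (Y i); set v := size (Y j). lia.
Qed.

(** The coefficient of degree 2n is the value of the form at the leading vector,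
    so that anisotropy excludes any cancellation: values have even degree. *)
Lemma size_qform B Y n : anisotropic B -> (forall i, (size (Y i) <= n.+1)%N) ->
  (exists i, (Y i)`_n != 0) ->
  size (qform (fun i j => (B i j)%:P) Y) = (n + n).+1.
Proof.
move=> aB sY [i0 Yi0]; apply/eqP; rewrite eqn_leq size_qform_leq //=.
rewrite ltnNge; apply/negP => /leq_sizeP/(_ _ (leqnn _)) top0.
suff /aB/(_ i0)/eqP : qform B (fun i => (Y i)`_n) = 0 by apply/negP.
apply: etrans top0; rewrite /qform coef_sum; apply: eq_bigr => i _.
rewrite coef_sum; apply: eq_bigr => j _.
rewrite -[in RHS]mulrA coefCM -[LHS]mulrA; congr (_ * _); symmetry.
have ltn : (n < (n + n).+1)%N by lia.
rewrite coefM (bigD1 (Ordinal ltn)) //= big1 ?addr0 ?addnK // => k.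
rewrite -val_eqE /= => ne.
have [lt|ge] := ltnP n k; first by rewrite nth_default ?mul0r //; apply: leq_trans (sY i) _.
by rewrite mulrC nth_default ?mul0r //; apply: leq_trans (sY j) _; lia.
Qed.

Lemma primitive_part Y : (exists i, Y i != 0) ->
  exists (c : {poly K}) (Z : I -> {poly K}), [/\ c != 0, forall i, Y i = Z i * c &
    forall d : {poly K}, (forall i, d %| Z i) -> size d = 1%N].
Proof.
case=> i0 Yi0; pose c := \big[@gcdp K/0]_i Y i.
have cP d : (d %| c) = [forall i, d %| Y i].
  rewrite /c; apply/idP/forallP => [dc i|dY].
    apply: dvdp_trans dc _; move: (mem_index_enum i).
    elim: (index_enum I) => // j e IH; rewrite inE big_cons.
    case/orP => [/eqP-> |/IH h]; first exact: dvdp_gcdl.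
    exact: dvdp_trans (dvdp_gcdr _ _) h.
  elim: (index_enum I) => [|j e IH]; first by rewrite big_nil dvdp0.
  by rewrite big_cons dvdp_gcd dY.
have cY i : c %| Y i by have := dvdpp c; rewrite cP => /forallP.
have c0 : c != 0 by apply: contraNneq Yi0 => e; have := cY i0; rewrite e dvd0p.
exists c, (fun i => Y i %/ c); split=> // [i|d dZ]; first by rewrite divpK.
have : d * c %| c.
  by rewrite cP; apply/forallP => i; rewrite -[Y i](divpK (cY i)) dvdp_mul2r.
by rewrite -[X in _ %| X]mul1r dvdp_mul2r // dvdp1 => /eqP.
Qed.

Lemma qform_modp B Y (p : {poly K}) :
  (p %| qform (fun i j => (B i j)%:P) (fun i => Y i %% p)) =
  (p %| qform (fun i j => (B i j)%:P) Y).
Proof.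
rewrite -!(sameP eqP (modp_eq0P _ _)).
have e i j : ((B i j)%:P * (Y i %% p) * (Y j %% p)) %% p =
   ((B i j)%:P * Y i * Y j) %% p.
  by rewrite modp_mul mulrAC modp_mul mulrAC.
suff -> : qform (fun i j => (B i j)%:P) (fun i => Y i %% p) %% p = 
  qform (fun i j => (B i j)%:P) Y %% p by [].
have mD (F : I -> {poly K}) : (\sum_i F i) %% p = \sum_i (F i %% p).
  by apply: (big_morph (fun q => q %% p)) => [a b|]; rewrite ?modpD ?mod0p.
rewrite /qform !mD; apply: eq_bigr => i _.
by rewrite !mD; apply: eq_bigr => j _.
Qed.

(** Springer's argument. Reduce Y modulo p and divide out its content; the value
    of the form is then p h, of even degree less than twice that of p, so h has odd
    degree less than that of p and the statement for h contradicts primitivity.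
    Stating it for all p of odd degree, with a common divisor in place of
    Y = 0 mod p, spares the choice of an irreducible factor of h. *)
Lemma springer_poly B Y (p : {poly K}) : anisotropic B -> p != 0 -> ~~ odd (size p) ->
  p %| qform (fun i j => (B i j)%:P) Y ->
  exists d : {poly K}, [/\ (1 < size d)%N, d %| p & forall i, d %| Y i].
Proof.
move=> aB; have [k] := ubnP (size p); elim: k => // k IH in p Y *.
rewrite ltnS => sp p0 op pY.
have sp1 : (1 < size p)%N.
  by move: op; rewrite -size_poly_gt0 in p0; case: (size p) p0 => [|[]].
have dmod d : d %| p -> (forall i, d %| Y i %% p) -> forall i, d %| Y i.
  by move=> dp dY i; rewrite (divp_eq (Y i) p) dvdp_add // dvdp_mull.
have [/forallP Y0|] := boolP [forall i, Y i %% p == 0].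
  by exists p; split=> //; apply: dmod => // i; rewrite (eqP (Y0 i)) dvdp0.
rewrite negb_forall => /existsP Yn0.
have [c [Z [c0 YZ Zprim]]] := primitive_part Yn0.
have [cop|ncop] := boolP (coprimep p c); last first.
  exists (gcdp p c); rewrite dvdp_gcdl; split=> //.
    rewrite ltn_neqAle eq_sym ncop lt0n size_poly_eq0 gcdp_eq0 (negPf p0) //.
  apply: dmod (dvdp_gcdl _ _) _ => i; rewrite YZ dvdp_mull //; exact: dvdp_gcdr.
have pZ : p %| qform (fun i j => (B i j)%:P) Z.
  rewrite -(Gauss_dvdpr _ (coprimep_expr 2 cop)) -qformZ.
  by move: pY; rewrite -qform_modp; congr (_ %| _); apply: eq_qform => i; rewrite YZ mulrC.
have [|n [sZ Zn]] := @leading_vector Z.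
  by case: Yn0 => i; rewrite YZ mulf_eq0 negb_or => /andP[? _]; exists i.
have np : (n.+1 < size p)%N.
  case: Zn => i Zi; have Zi0 : Z i != 0 by apply: contraNneq Zi => ->; rewrite coef0.
  have : (size (Z i * c)%R < size p)%N by rewrite -YZ ltn_modp.
  apply: leq_ltn_trans; apply: (@leq_trans (size (Z i))).
    by rewrite ltnNge; apply/negP => /leq_sizeP/(_ _ (leqnn _)) e; rewrite e eqxx in Zi.
  rewrite size_mul //; rewrite -size_poly_gt0 in c0.
  by move: c0; set u := size c; set v := size (Z i); lia.
have sq := size_qform aB sZ Zn.
case/dvdpP: pZ => h qE.
have h0 : h != 0 by apply: contraPneq sq => e; rewrite qE e mul0r size_poly0.
have sh : (size h + size p = (n + n).+2)%N.
  by rewrite -sq qE size_mul // prednK // addn_gt0 !size_poly_gt0 h0.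
have [||||d [sd dh dZ]] := IH h Z; rewrite ?qE ?dvdp_mulIl //.
- by move: sp np sh; lia.
- by have := congr1 odd sh; rewrite oddD /= negbK oddD addbb (negPf op) addbF => ->.
by move: sd; rewrite (Zprim d dZ).
Qed.
End PolyForms.

(** * Springer's theorem *)

Lemma odd_irreducible_factor (K : fieldType) (f : {poly K}) :
  f != 0 -> ~~ odd (size f) ->
  exists p : {poly K}, [/\ irreducible_poly p, ~~ odd (size p) & p %| f].
Proof.
have [k] := ubnP (size f); elim: k => // k IH in f *; rewrite ltnS => sf f0 ef.
have sf1 : (1 < size f)%N.
  by move: ef; rewrite -size_poly_gt0 in f0; case: (size f) f0 => [|[]].
have [irr|red] := classic (irreducible_poly f); first by exists f; rewrite dvdpp.
have [q [sq1 qf nq]] : exists q : {poly K}, [/\ size q != 1%N, q %| f & ~~ (q %= f)].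
  apply: NNPP => none; apply: red; split=> // q sq qf.
  by have [//|nq] := boolP (q %= f); case: none; exists q.
have [h fE] := dvdpP _ _ qf.
have [h0 q0] : h != 0 /\ q != 0.
  by split; [move: f0; rewrite fE mulf_eq0 negb_or => /andP[]|
             move: f0; rewrite fE mulf_eq0 negb_or => /andP[]].
have sE : (size f + 1 = size h + size q)%N.
  by rewrite fE size_mul // addn1 prednK // addn_gt0 !size_poly_gt0 h0.
have ltq : (size q < size f)%N.
  rewrite ltn_neqAle dvdp_leq // andbT; apply: contra nq => /eqP e.
  by rewrite -dvdp_size_eqp // e.
have sq2 : (1 < size q)%N by rewrite ltn_neqAle eq_sym sq1 size_poly_gt0.
have [oq|oq] := boolP (odd (size q)); last first.
  have [p [pi po pq]] := IH q (leq_trans ltq sf) q0 oq.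
  by exists p; split=> //; apply: dvdp_trans pq qf.
have [|||p [pi po ph]] := IH h; rewrite //.
- by move: sE sq2 sf; lia.
- have := congr1 odd sE; rewrite !oddD oq (negPf ef) /=.
  by case: (odd (size h)).
- by exists p; split=> //; rewrite fE dvdp_mulr.
Qed.

(** One step of odd degree that produces a root of f and keeps B anisotropic. *)
Lemma springer_extension (K : fieldType) (I : finType) (B : I -> I -> K)
  (f : {poly K}) : anisotropic B -> f != 0 -> ~~ odd (size f) ->
  exists (L : fieldType) (g : {rmorphism K -> L}),
    anisotropic (fun i j => g (B i j)) /\ exists z, root (map_poly g f) z.
Proof.
move=> aB f0 ef; have [p [pi po pf]] := odd_irreducible_factor f0 ef.
have [L _ [z rz genz]] := irredp_FAdjoin pi.
have p0 : p != 0 by rewrite -size_poly_gt0; case: pi => /ltnW.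
exists L, (in_alg L); split; last first.
  by exists z; case/dvdpP: pf => h ->; rewrite rmorphM rootM rz orbT.
move=> x qx.
have [Y xY] : exists Y : I -> {poly K}, forall i, x i = (map_poly (in_alg L) (Y i)).[z].
  suff h (i : I) : exists q : {poly K}, x i = (map_poly (in_alg L) q).[z].
    exact: fin_all_exists h.
  have /Fadjoin_polyP[q q1 ->] : x i \in <<1; z>>%VS by rewrite genz memvf.
  by have /polyOver1P[r ->] := q1; exists r.
have dv (q : {poly K}) : (p %| q) = root (map_poly (in_alg L) q) z.
  apply/idP/idP => [/dvdpP[h ->]|rq]; first by rewrite rmorphM rootM rz orbT.
  apply: contraTT rq; rewrite -irreducible_poly_coprime // => cop.
  rewrite -(coprimep_map (in_alg L)) in cop.
  exact: coprimep_root cop rz.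
have : p %| qform (fun i j => (B i j)%:P) Y.
  pose ev : {rmorphism {poly K} -> L} := horner_eval z \o map_poly (in_alg L).
  rewrite dv rootE -[_.[z]]/(ev _) rmorph_qform; apply/eqP; apply: etrans qx.
  apply: eq_bigr => i _; apply: eq_bigr => j _.
  by rewrite /ev /= /horner_eval map_polyC hornerC !xY.
case/(springer_poly aB p0 po) => d [d1 dp dY] i.
have [_ /(_ d)] := pi; rewrite dp neq_ltn d1 orbT => /(_ isT isT) /eqp_dvdl dpE.
by rewrite xY; apply/eqP; rewrite -rootE -dv -dpE.
Qed.

(** * Forms over rational function fields *)

Section RationalFunctions.
Variable K : fieldType.

Definition ratfun : fieldType := {fraction {poly K}}.
Definition rconst : {rmorphism K -> ratfun} := @tofrac _ \o polyC.
Definition rvar : ratfun := tofrac 'X.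

Lemma ratfun_denom (x : ratfun) :
  exists p q : {poly K}, q != 0 /\ tofrac q * x = tofrac p.
Proof.
elim/quotW: x => u; exists (frac u).1, (frac u).2; split; first exact: denom_ratioP.
unlock tofrac; rewrite -[LHS]FracField.pi_mul /FracField.mulf.
apply/eqmodP; rewrite /= FracField.equivfE.
have du := denom_ratioP u.
by rewrite !numden_Ratio ?oner_neq0 ?mul1r ?mulr1 // mulrC.
Qed.

Lemma common_denominator (I : finType) (x : I -> ratfun) :
  exists (c : {poly K}) (Y : I -> {poly K}),
    c != 0 /\ forall i, tofrac c * x i = tofrac (Y i).
Proof.
have [p hp] := fin_all_exists (fun i => ratfun_denom (x i)).
have [q hq] := fin_all_exists hp.
exists (\prod_i q i), (fun i => p i * \prod_(j | j != i) q j); split.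
  by apply/prodf_neq0 => i _; case: (hq i).
move=> i; rewrite (bigD1 i) //= !rmorphM /= -(proj2 (hq i)); ring.
Qed.

(** Denominators can be cleared because the form is homogeneous. *)
Lemma anisotropic_poly (I : finType) (B : I -> I -> {poly K}) :
  (forall Y, qform B Y = 0 -> forall i, Y i = 0) ->
  anisotropic (fun i j => tofrac (B i j) : ratfun).
Proof.
move=> aB x qx; have [c [Y [c0 xY]]] := common_denominator x.
have c0' : tofrac c != 0 :> ratfun by rewrite tofrac_eq0.
suff Y0 i : Y i = 0.
  by move=> i; apply: (mulfI c0'); rewrite xY Y0 mulr0 rmorph0.
apply: aB i; apply/eqP; rewrite -tofrac_eq0 rmorph_qform.
have <- : qform (fun i j => tofrac (B i j)) (fun i => tofrac c * x i) = 
  qform (fun i j => tofrac (B i j)) (fun i => tofrac (Y i)) by apply: eq_qform.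
by rewrite qformZ qx mulr0.
Qed.

(** For a polynomial vector with leading degree n, the first summand has degree
    2n + 1 and the second at most 2n: they cannot cancel. *)
Lemma anisotropic_pencil (I : finType) (B C : I -> I -> K) : anisotropic B ->
  anisotropic (fun i j => rvar * rconst (B i j) + rconst (C i j)).
Proof.
move=> aB.
have e i j : rvar * rconst (B i j) + rconst (C i j) =
   tofrac ('X * (B i j)%:P + (C i j)%:P) by rewrite rmorphD rmorphM.
suff : anisotropic (fun i j => tofrac ('X * (B i j)%:P + (C i j)%:P) : ratfun).
  move=> h x qx; apply: h; rewrite -qx.
  by apply: eq_bigr => i _; apply: eq_bigr => j _; rewrite e.
apply: anisotropic_poly => Y qY i; apply/eqP; apply/idPn => Yi.
have [|n [sY Yn]] := @leading_vector _ _ Y; first by exists i.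
have sB := size_qform aB sY Yn; have sC := size_qform_leq C sY.
set qB := qform _ Y in sB; set qC := qform _ Y in sC.
have qE : qform (fun i j => 'X * (B i j)%:P + (C i j)%:P) Y = qB * 'X + qC.
  rewrite /qB /qC /qform mulr_suml -big_split; apply: eq_bigr => a _ /=.
  by rewrite mulr_suml -big_split; apply: eq_bigr => b _ /=; ring.
have qB0 : qB != 0 by rewrite -size_poly_gt0 sB.
have : size (qB * 'X + qC) = (n + n).+2.
  by rewrite size_polyDl size_mulX // sB.
by rewrite -qE qY size_poly0.
Qed.

Definition sum_form (R : pzRingType) (t : R) (I J : finType)
   (B : I -> I -> R) (C : J -> J -> R) (u v : I + J) : R :=
  match u, v with
  | inl i, inl j => B i j
  | inr i, inr j => t * C i j
  | _, _ => 0
  end.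

Lemma qform_sum (R : comNzRingType) (t : R) (I J : finType)
   (B : I -> I -> R) (C : J -> J -> R) x :
  qform (sum_form t B C) x = qform B (x \o inl) + t * qform C (x \o inr).
Proof.
rewrite /qform big_sumType mulr_sumr; congr (_ + _); apply: eq_bigr => i _.
  by rewrite big_sumType /= [X in _ + X]big1 ?addr0 // => j _; rewrite !mul0r.
rewrite big_sumType /= big1 ?add0r => [|j _]; last by rewrite !mul0r.
by rewrite mulr_sumr; apply: eq_bigr => j _; ring.
Qed.

(** The values of the two summands have degrees of different parity. *)
Lemma anisotropic_sum (I J : finType) (B : I -> I -> K) (C : J -> J -> K) :
  anisotropic B -> anisotropic C ->
  anisotropic (sum_form rvar (fun i j => rconst (B i j)) (fun i j => rconst (C i j))).
Proof.
move=> aB aC.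
suff : anisotropic (fun u v => tofrac (sum_form 'X (fun i j => (B i j)%:P) 
    (fun i j => (C i j)%:P) u v) : ratfun).
  move=> h x qx; apply: h; rewrite -qx; apply: eq_bigr => u _; apply: eq_bigr => v _.
  by congr (_ * _ * _); case: u v => u [] v /=; rewrite ?rmorph0 ?rmorphM.
apply: anisotropic_poly => Y; rewrite qform_sum => qY.
set qB := qform _ _ in qY; set qC := qform _ _ in qY.
have hB : (forall i, Y (inl i) = 0) \/ odd (size qB).
  have [/forallP h|] := boolP [forall i, Y (inl i) == 0].
    by left=> i; apply/eqP.
  rewrite negb_forall => /existsP/leading_vector[n [sY Yn]].
  by right; rewrite (size_qform aB sY Yn) addnn /= odd_double.
have hC : (forall i, Y (inr i) = 0) \/ odd (size qC).
  have [/forallP h|] := boolP [forall i, Y (inr i) == 0].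
    by left=> i; apply/eqP.
  rewrite negb_forall => /existsP/leading_vector[n [sY Yn]].
  by right; rewrite (size_qform aC sY Yn) addnn /= odd_double.
have q0 (T : finType) (D : T -> T -> {poly K}) (y : T -> {poly K}) :
    (forall i, y i = 0) -> qform D y = 0.
  by move=> y0; apply: big1 => i _; apply: big1 => j _; rewrite y0 mulr0 mul0r.
have qBE : qB = - ('X * qC) by apply/eqP; rewrite -addr_eq0 qY.
case: hB hC => [B0|oB] [C0|oC].
- by case.
- move: oC; have /eqP := qBE; rewrite [qB]q0 // eq_sym oppr_eq0.
  by rewrite mulf_eq0 polyX_eq0 => /eqP->; rewrite size_poly0.
- by move: oB; rewrite qBE [qC]q0 // mulr0 oppr0 size_poly0.
- have qC0 : qC != 0 by apply/eqP => e; move: oC; rewrite e size_poly0.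
  by move: oB; rewrite qBE size_polyN mulrC size_mulX //= oC.
Qed.

End RationalFunctions.

(** * Common eigenvectors in odd dimension *)

(** A - c is nilpotent; with a free exponent, this passes at once to stable
    subspaces and to larger fields. *)
Definition one_eigenvalue (K : fieldType) n (A : 'M[K]_n) : Prop :=
  exists c e, (1%:M <= kermxpoly A (('X - c%:P) ^+ e))%MS.

Lemma one_eigenvalue_restrict (K : fieldType) n (A V : 'M[K]_n) :
  stablemx V A -> one_eigenvalue A -> one_eigenvalue (restrictmx V A).
Proof.
move=> sV [c [e h]]; exists c, e.
rewrite sub_kermxpoly_conjmx ?stablemx_row_base ?row_base_free // mul1mx.
exact: submx_trans (submx1 _) h.
Qed.

Lemma one_eigenvalue_map (K L : fieldType) (g : {rmorphism K -> L}) n (A : 'M[K]_n) :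
  one_eigenvalue A -> one_eigenvalue (map_mx g A).
Proof.
case=> c [e h]; exists (g c), e; move: h; rewrite -(map_submx g) map_mx1 map_kermxpoly.
by rewrite rmorphXn rmorphB /= map_polyX map_polyC.
Qed.

Lemma one_eigenvalueP (K : fieldType) n (A : 'M[K]_n) :
  (0 < n)%N -> one_eigenvalue A -> exists c, eigenspace A c != 0.
Proof.
case: n A => // n A _ [c [e h]]; exists c; apply: contraTneq h => /eqP.
rewrite eigenspace_poly /kermxpoly kermx_eq0 row_free_unit => u.
have : kermx (horner_mx A (('X - c%:P) ^+ e)) == 0.
  rewrite kermx_eq0 row_free_unit rmorphXn /=.
  by elim: e => [|e IH]; rewrite ?expr0 ?unitmx1 // exprS unitmx_mul u.
by move/eqP->; rewrite submx0 -mxrank_eq0 mxrank1.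
Qed.

Lemma commuting_restrict (K : fieldType) n (V : 'M[K]_n) (As : seq 'M[K]_n) :
  {in As, forall A, stablemx V A} -> {in As &, forall A B, comm_mx A B} ->
  {in map (restrictmx V) As &, forall A B, comm_mx A B}.
Proof.
move=> sV cA _ _ /mapP[A iA ->] /mapP[B iB ->].
by rewrite /comm_mx -!conjmxM ?inE ?stablemx_row_base ?sV // cA.
Qed.

(** The eigenspace of the first operator is stable under the others, whose
    restrictions again have one eigenvalue in the field. *)
Lemma common_eigenvector_one_eigenvalue (K : fieldType) n (As : seq 'M[K]_n) :
  (0 < n)%N -> {in As &, forall A B, comm_mx A B} ->
  {in As, forall A, one_eigenvalue A} ->
  exists2 v : 'rV_n, v != 0 & {in As, forall A, stablemx v A}.
Proof.
have [k] := ubnP (size As); elim: k n As => // k IH n [|A As].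
  move=> _ n0 _ _; exists (const_mx 1) => //.
  by apply/negP => /eqP/rowP/(_ (Ordinal n0)); rewrite !mxE => /eqP; rewrite oner_eq0.
rewrite ltnS => sAs n0 cA oA.
have [c nc] := one_eigenvalueP n0 (oA A (mem_head _ _)).
have sub : {subset As <= A :: As} by move=> B iB; rewrite inE iB orbT.
have sV : {in As, forall B, stablemx (eigenspace A c) B}.
  by move=> B iB; apply: comm_mx_stable_eigenspace; apply: cA; rewrite ?mem_head ?sub.
have [||||v v0 vP] := IH _ (map (restrictmx (eigenspace A c)) As).
- by rewrite size_map.
- by rewrite lt0n mxrank_eq0.
- by apply: commuting_restrict => // B C iB iC; apply: cA; apply: sub.
- by move=> _ /mapP[B iB ->]; apply: one_eigenvalue_restrict; [apply: sV|apply/oA/sub].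
exists (v *m row_base (eigenspace A c)); first by rewrite mulmx_free_eq0 ?row_base_free.
move=> B; rewrite inE => /orP[/eqP->|iB].
  by apply/eigenvectorP; exists c; rewrite mulmx_sub // eq_row_base.
by rewrite -stablemx_restrict ?sV //; apply: vP; apply: map_f.
Qed.

(** Splitting the characteristic polynomial into a power of 'X - z and a factor
    without the root z splits the space into two kernels, and one of them has odd
    dimension. The second is proper because z is an eigenvalue; if the first is not,
    z is the only eigenvalue. *)
Lemma odd_summand (K : fieldType) n (A : 'M[K]_n) z : odd n -> root (char_poly A) z ->
  one_eigenvalue A \/
  exists p, odd (\rank (kermxpoly A p)) /\ (\rank (kermxpoly A p) < n)%N.
Proof.
case: n A => // n A on rz.
have [e [h rh cE]] := multiplicity_XsubC (char_poly A) z.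
have := monic_neq0 (char_poly_monic A) => c0; rewrite c0 /= in rh.
pose p := ('X - z%:P) ^+ e.
have cop : coprimep h p by rewrite coprimep_expr // coprimep_XsubC.
have full : (kermxpoly A h + kermxpoly A p :=: 1)%MS.
  apply: eqmx_trans (eqmx_sym (kermxpolyM A cop)) _; rewrite -cE.
  exact: kermxpoly_min (mxminpoly_dvd_char A).
have rk : (\rank (kermxpoly A h) + \rank (kermxpoly A p) = n.+1)%N.
  by rewrite -mxrank_disjoint_sum ?mxdirect_kermxpoly // full mxrank1.
have p1 : (0 < \rank (kermxpoly A p))%N.
  have e0 : (0 < e)%N.
    rewrite lt0n; apply: contraNneq rh => e0.
    by move: rz; rewrite cE e0 expr0 mulr1.
  move: rz; rewrite -eigenvalue_root_char /eigenvalue lt0n mxrank_eq0.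
  apply: contraNneq => k0; rewrite -submx0 -k0 eigenspace_poly /p -(prednK e0).
  rewrite /kermxpoly exprS rmorphM /=; apply/sub_kermxP.
  by rewrite -mulmxE mulmxA mulmx_ker mul0mx.
have [full1|nfull] := eqVneq (\rank (kermxpoly A p)) n.+1.
  by left; exists z, e; rewrite sub1mx -/p /row_full full1.
have [o|o] := boolP (odd (\rank (kermxpoly A p))); right.
  by exists p; split=> //; rewrite ltn_neqAle nfull rank_leq_row.
exists h; split; last by move: rk p1; lia.
by have := congr1 odd rk; rewrite oddD (negPf o) addbF => ->.
Qed.

(** The outer induction is on the dimension, the inner one on the number of
    operators not known to have a single eigenvalue. Such an operator has an
    eigenvalue after a step of odd degree, since its characteristic polynomial has odd
    degree; either it joins the operators with one eigenvalue, or a stable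
    subspace of smaller odd dimension appears. *)
Lemma odd_common_eigenvector n (K : fieldType) (I : finType) (B : I -> I -> K)
   (As : seq 'M[K]_n) :
  anisotropic B -> odd n -> {in As &, forall A C, comm_mx A C} ->
  exists (L : fieldType) (g : {rmorphism K -> L}),
    anisotropic (fun i j => g (B i j)) /\
    exists2 v : 'rV[L]_n, v != 0 & {in As, forall A, stablemx v (map_mx g A)}.
Proof.
have [k] := ubnP n; elim: k n => // k IHn n in K B As *; rewrite ltnS => nk.
suff [s]: exists s, size As = s; last by exists (size As).
move=> sAs aB on cA.
suff gen: forall s (Gs Bs : seq 'M[K]_n), size Bs = s -> 
  {in Gs ++ Bs &, forall A C, comm_mx A C} -> {in Gs, forall A, one_eigenvalue A} ->
  exists (L : fieldType) (g : {rmorphism K -> L}),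
    anisotropic (fun i j => g (B i j)) /\
    exists2 v : 'rV[L]_n, v != 0 & {in Gs ++ Bs, forall A, stablemx v (map_mx g A)}.
  exact: (gen _ [::] As).
clear s As sAs cA => s.
elim: s => [|s IHs] in K B aB *; move=> Gs [|A Bs] //.
  rewrite cats0 => _ cA oA.
  have n0 : (0 < n)%N by case: (n) on.
  have [v v0 vP] := common_eigenvector_one_eigenvalue n0 cA oA.
  exists K, idfun; split=> //; exists v => // C iC.
  by rewrite map_mx_id //; apply: vP.
case=> sBs cA oA.
have chi_odd : ~~ odd (size (char_poly A)) by rewrite size_char_poly /= negbK.
have [L [g [aL [z rz]]]] :=
  springer_extension aB (monic_neq0 (char_poly_monic A)) chi_odd.
rewrite map_char_poly in rz.
have cG : {in map (map_mx g) (Gs ++ A :: Bs) &, forall A C, comm_mx A C}.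
  move=> _ _ /mapP[C iC ->] /mapP[D iD ->].
  by rewrite /comm_mx -!map_mxM cA.
have memA : A \in Gs ++ A :: Bs by rewrite mem_cat mem_head orbT.
have fin (L' : fieldType) (h : {rmorphism L -> L'}) : 
  anisotropic (fun i j => h (g (B i j))) ->
  (exists2 v : 'rV[L']_n, v != 0 &
     {in Gs ++ A :: Bs, forall C, stablemx v (map_mx h (map_mx g C))}) ->
  exists (L : fieldType) (g : {rmorphism K -> L}),
    anisotropic (fun i j => g (B i j)) /\
    exists2 v : 'rV[L]_n, v != 0 & {in Gs ++ A :: Bs, forall C, stablemx v (map_mx g C)}.
  move=> aL' [v v0 vP]; exists L', (h \o g); split=> //; exists v => // C iC.
  by have := vP C iC; rewrite -map_mx_comp.
have [oe|[p [op ltp]]] := odd_summand on rz.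
  have [|||L' [h [aL' [v v0 vP]]]] :=
    IHs L _ aL (map_mx g A :: map (map_mx g) Gs) (map (map_mx g) Bs).
  - by rewrite size_map.
  - move=> C D iC iD; apply: cG.
      by move: iC; rewrite map_cat /= inE !mem_cat inE orbCA.
    by move: iD; rewrite map_cat /= inE !mem_cat inE orbCA.
  - move=> C; rewrite inE => /orP[/eqP->//|/mapP[D iD ->]].
    exact/one_eigenvalue_map/oA.
  apply: (fin L' h aL'); exists v => // C iC; apply: vP.
  have := map_f (map_mx g) iC.
  by rewrite map_cat /= inE !mem_cat inE orbCA.
set V := kermxpoly _ p in op ltp.
have sV : {in map (map_mx g) (Gs ++ A :: Bs), forall C, stablemx V C}.
  by move=> C iC; apply: comm_mx_stable_kermxpoly; apply: cG => //; apply: map_f.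
have [|L' [h [aL' [v v0 vP]]]] := IHn _ L _
  (map (restrictmx V) (map (map_mx g) (Gs ++ A :: Bs))) (leq_trans ltp nk) aL op.
  exact: commuting_restrict.
apply: (fin L' h aL'); exists (v *m map_mx h (row_base V)).
  by rewrite mulmx_free_eq0 // /row_free mxrank_map -/(row_free _) row_base_free.
move=> C iC; have iC' := map_f (map_mx g) iC.
have := vP _ (map_f (restrictmx V) iC'); set C' := map_mx g C in iC' *.
move/(submxMr (map_mx h (row_base V))).
rewrite -mulmxA -map_mxM mulmxKpV ?stablemx_row_base ?sV //.
by rewrite map_mxM mulmxA.
Qed.

(** * Alternating contractions of symmetric tensors *)

Definition upd (I : finType) (T : Type) (t : I -> T) (s : I) (c : T) : I -> T :=
  fun u => if u == s then c else t u.

(** Families of matrices A_j, of entries A j i c, act on tensors of degree k, given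
    by their coordinates in {ffun 'I_k -> 'I_a}. *)
Section Tensors.
Variables (R : comNzRingType) (k a m b : nat).
Variable (A : 'I_b -> 'I_m -> 'I_a -> R).
Notation index := {ffun 'I_k -> 'I_a}.

Definition permute (t : index) (p : 'S_k) : index := [ffun s => t (p s)].
Definition slot (t : index) s c : index := [ffun u => upd t s c u].

Definition symmetric_tensor (w : index -> R) := forall t p, w (permute t p) = w t.

(** The coordinate, for the rows r, of the image of the tensor w in the exterior
    power when the matrix A_(l s) is applied to the factor in position s: on a pure
    tensor v (x) .. (x) v it is a minor of the matrix with columns A_(l s) v. *)
Definition wedge (l : 'I_k -> 'I_b) (w : index -> R) (r : 'I_k -> 'I_m) : R :=
  \sum_t w t * \det (\matrix_(i, s) A (l s) (r i) (t s)).

Lemma eq_wedge l l' w r : l =1 l' -> wedge l w r = wedge l' w r.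
Proof.
move=> e; apply: eq_bigr => t _; congr (_ * \det _).
by apply/matrixP => i s; rewrite !mxE e.
Qed.

Lemma wedge_permute l w r (p : 'S_k) : symmetric_tensor w ->
  wedge (fun s => l (p s)) w r = (-1) ^+ p * wedge l w r.
Proof.
move=> sw; rewrite /wedge mulr_sumr (reindex_inj (h := permute^~ p)) /=; last first.
  move=> t t' /ffunP e; apply/ffunP => s.
  by have := e (p^-1 s)%g; rewrite !ffunE permKV.
apply: eq_bigr => t _; rewrite sw mulrCA; congr (_ * _).
have -> : \matrix_(i, s) A (l (p s)) (r i) (permute t p s) =
   (\matrix_(i, s) A (l s) (r i) (t s)) *m perm_mx (p^-1)%g.
  by rewrite -col_permE; apply/matrixP => i s; rewrite !mxE ffunE.
by rewrite det_mulmx det_perm odd_permV mulrC.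
Qed.

Lemma sum_over_slot (s : 'I_k) (f : index -> R) :
  (forall t, \sum_c f (slot t s c) = 0) -> \sum_t f t = 0.
Proof.
move=> f0; have [t0 _|no] := pickP (@predT index); last first.
  by apply: big1 => t _; have := no t.
rewrite (partition_big (fun t => slot t s (t0 s)) (fun t => t s == t0 s)) /=; last first.
  by move=> t _; rewrite ffunE /upd eqxx.
apply: big1 => t /eqP ts; rewrite -[RHS](f0 t).
rewrite (reindex_onto (slot t s) (fun u : index => u s)) /=.
  apply: eq_bigl => c; rewrite ffunE /upd eqxx eqxx andbT.
  apply/eqP/ffunP => u; rewrite !ffunE /upd !ffunE /upd; case: eqP => // ->.
  by rewrite ts.
move=> u /eqP <-; apply/ffunP => v; rewrite !ffunE /upd !ffunE /upd.
by case: eqP => // ->.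
Qed.

(** Expanding the determinant along column s leaves cofactors that do not depend on
    the index in slot s, so that the relation between the y_j can be summed over it. *)
Lemma wedge_slot (y : 'I_b -> index -> R) s l r :
  (forall i t, \sum_j \sum_c A j i c * y j (slot t s c) = 0) ->
  \sum_j wedge (upd l s j) (y j) r = 0.
Proof.
move=> y0.
pose cof (t : index) i := cofactor (\matrix_(i, u) A (l u) (r i) (t u)) i s.
have cofE (t : index) i j : cofactor (\matrix_(i, u) A (upd l s j u) (r i) (t u)) i s = cof t i.
  rewrite /cof /cofactor; congr (_ * \det _); apply/matrixP => i' u.
  by rewrite !mxE /upd eq_sym (negPf (neq_lift _ _)).
have cofS t i c : cof (slot t s c) i = cof t i.
  rewrite /cof /cofactor; congr (_ * \det _); apply/matrixP => i' u.
  by rewrite !mxE ffunE /upd eq_sym (negPf (neq_lift _ _)).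
have -> : \sum_j wedge (upd l s j) (y j) r =
   \sum_t \sum_i cof t i * \sum_j A j (r i) (t s) * y j t.
  rewrite exchange_big /=; apply: eq_bigr => t _.
  under eq_bigr => j _ do rewrite (expand_det_col _ s) mulr_sumr.
  rewrite exchange_big /=; apply: eq_bigr => i _; rewrite mulr_sumr.
  by apply: eq_bigr => j _; rewrite cofE mxE /upd eqxx; ring.
apply: (@sum_over_slot s) => t; rewrite exchange_big /=; apply: big1 => i _.
under eq_bigr => c _ do rewrite cofS ffunE /upd eqxx.
rewrite -mulr_sumr exchange_big /=.
by rewrite y0 mulr0.
Qed.

End Tensors.

(** Exchanging the slots s and s' fixes the labels and the tensor but changes the
    sign of the determinant. *)
Lemma wedge_dup (K : fieldType) (k a m b : nat) (A : 'I_b -> 'I_m -> 'I_a -> K)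
  l (w : {ffun 'I_k -> 'I_a} -> K) r s s' : 2%:R != 0 :> K ->
  symmetric_tensor w -> s != s' -> l s = l s' -> wedge A l w r = 0.
Proof.
move=> two sw ne ls; have := wedge_permute A l r (tperm s s') sw.
rewrite (@eq_wedge _ _ _ _ _ A _ l); last by move=> u; case: tpermP => // ->.
rewrite odd_tperm ne expr1 mulN1r => /eqP; rewrite -addr_eq0 -mulr2n -mulr_natl.
by rewrite mulf_eq0 (negPf two) => /eqP.
Qed.

(** * Coordinates on symmetric tensors *)

Section Classes.
Variable a : nat.
Let r : rel 'I_a := relpre val leq.

Let r_total : total r. Proof. by move=> x y; apply: leq_total. Qed.
Let r_trans : transitive r. Proof. by move=> x y z; apply: leq_trans. Qed.
Let r_anti : antisymmetric r. Proof. by move=> x y /anti_leq/val_inj. Qed.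

(** Symmetric tensors are functions of the multiset of indices, here the sorted
    tuple. *)
Definition multiset k := {x : k.-tuple 'I_a | sorted leq (map val x)}.

Lemma sort_multiset_subproof k (t : {ffun 'I_k -> 'I_a}) :
  sorted leq (map val [tuple of sort r [tuple t i | i < k]]).
Proof. by rewrite sorted_map sort_sorted. Qed.

Definition content k (t : {ffun 'I_k -> 'I_a}) : multiset k :=
  exist (fun x : k.-tuple 'I_a => sorted leq (map val x)) _ (sort_multiset_subproof t).

Lemma content_eq k (t u : {ffun 'I_k -> 'I_a}) :
  (content t == content u) = perm_eq (map t (enum 'I_k)) (map u (enum 'I_k)).
Proof. by rewrite -!val_eqE; apply/eqP/(perm_sortP r_total r_trans r_anti). Qed.

Lemma content_permute k (t : {ffun 'I_k -> 'I_a}) p : content (permute t p) = content t.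
Proof.
apply/eqP; rewrite content_eq.
have -> : map (permute t p) (enum 'I_k) = map t (map p (enum 'I_k)).
  by rewrite -[RHS]map_comp; apply: eq_map => s; rewrite ffunE.
apply: perm_map; apply: uniq_perm; rewrite ?enum_uniq ?(map_inj_uniq perm_inj) ?enum_uniq //.
by move=> s; rewrite mem_enum -[s](permKV p) map_f ?mem_enum.
Qed.

Lemma content_surj k (x : multiset k) : exists t, content t = x.
Proof.
case: x => x sx; exists [ffun i => tnth x i]; apply/val_inj/val_inj => /=.
rewrite sorted_map in sx; rewrite -[RHS](sorted_sort r_trans sx); congr sort.
rewrite -[in RHS](map_tnth_enum x); apply: eq_map => i; exact: ffunE.
Qed.

Definition ffcons k c (t : {ffun 'I_k -> 'I_a}) : {ffun 'I_k.+1 -> 'I_a} :=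
  [ffun i => oapp t c (unlift ord0 i)].

Lemma content_cons k c (t u : {ffun 'I_k -> 'I_a}) :
  content t = content u -> content (ffcons c t) = content (ffcons c u).
Proof.
move/eqP; rewrite content_eq => tu; apply/eqP; rewrite content_eq.
have e (v : {ffun 'I_k -> 'I_a}) :
    map (ffcons c v) (enum 'I_k.+1) = c :: map v (enum 'I_k).
  rewrite enum_ordSl /= ffunE unlift_none -map_comp; congr (_ :: _).
  by apply: eq_map => s; rewrite /= ffunE liftK.
by rewrite !e perm_cons.
Qed.

(** For symmetric tensors, acting on slot s amounts to acting on the first slot;
    the other indices u do not depend on c. *)
Lemma slot_permute k (t : {ffun 'I_k.+1 -> 'I_a}) s : exists u : {ffun 'I_k -> 'I_a},
  forall c, content (slot t s c) = content (ffcons c u).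
Proof.
exists [ffun j => t (tperm ord0 s (lift ord0 j))] => c.
rewrite -(content_permute _ (tperm ord0 s)); congr content; apply/ffunP => i.
rewrite !ffunE /upd; case: unliftP => [j ->|->] /=; last by rewrite tpermL eqxx.
rewrite ffunE ifN // -[X in _ != X](tpermL ord0 s) (inj_eq perm_inj).
by rewrite eq_sym neq_lift.
Qed.

End Classes.

Lemma card_multiset k a : #|{: multiset a.+1 k}| = 'C(k + a, k).
Proof. by rewrite card_sig -card_sorted_tuples cardsE. Qed.

(** * The multiparameter eigenvalue problem *)

Definition class_index k a (t : {ffun 'I_k -> 'I_a}) : 'I_#|{: multiset a k}| :=
  enum_rank (content t).

Definition tensor (R : Type) k a (v : 'rV[R]_#|{: multiset a k}|)
  (t : {ffun 'I_k -> 'I_a}) : R := v 0 (class_index t).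

(** The slots carry A_1, .., A_k. This excludes solutions of sum_j y_j A_j x = 0 with
    y_0 = 0: then A_1 x, .., A_k x would be dependent, and all the contractions of
    x (x) .. (x) x would vanish. *)
Definition nondegenerate (R : comNzRingType) k m a (A : 'I_k.+1 -> 'I_m -> 'I_a -> R) :=
  forall v : 'rV_#|{: multiset a k}|,
    (forall r, wedge A (lift ord0) (tensor v) r = 0) -> v = 0.

Section Multiparameter.
Variables (K : fieldType) (k a m : nat).
Variable A : 'I_k.+2 -> 'I_m -> 'I_a.+1 -> K.
Hypotheses (two : 2%:R != 0 :> K) (mE : m = (k.+1 + a)%N) (ndA : nondegenerate A).

Notation N := #|{: multiset a.+1 k.+1}|.
Notation N' := #|{: multiset a.+1 k}|.
Let ax : 'I_k.+1 -> 'I_k.+2 := lift ord0.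

(** The relation sum_j A_j y_j = 0, where A_j acts on the first factor. *)
Let solution (y : 'I_k.+2 -> 'rV[K]_N) : Prop :=
  forall i (u : {ffun 'I_k -> 'I_a.+1}), \sum_j \sum_c A j i c * tensor (y j) (ffcons c u) = 0.

Let tensor_sym (v : 'rV[K]_N) : symmetric_tensor (tensor v).
Proof. by move=> t p; rewrite /tensor /class_index content_permute. Qed.

Let tensorN (v : 'rV[K]_N) t : tensor (- v) t = - tensor v t.
Proof. by rewrite /tensor mxE. Qed.
Let wedgeN l (v : 'rV[K]_N) r : wedge A l (tensor (- v)) r = - wedge A l (tensor v) r.
Proof. by rewrite -sumrN; apply: eq_bigr => t _; rewrite tensorN mulNr. Qed.
Let wedgeD l (v w : 'rV[K]_N) r :
  wedge A l (tensor (v + w)) r = wedge A l (tensor v) r + wedge A l (tensor w) r.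
Proof. by rewrite -big_split; apply: eq_bigr => t _; rewrite /tensor mxE mulrDl. Qed.
Let wedge0 l r : wedge A l (tensor (0 : 'rV[K]_N)) r = 0.
Proof. by apply: big1 => t _; rewrite /tensor mxE mul0r. Qed.

Let solution_wedge y l s r : solution y ->
  \sum_j wedge A (upd l s j) (tensor (y j)) r = 0.
Proof.
move=> sy; apply: wedge_slot => i t; have [u hu] := slot_permute t s.
rewrite -[RHS](sy i u); apply: eq_bigr => j _; apply: eq_bigr => c _.
by rewrite /tensor /class_index hu.
Qed.

(** In the sum over the label of slot s, every label other than those of s and s'
    already occurs in another slot, so only two terms survive. *)
Let exchange y l s s' r : solution y -> l s' = ord0 -> s != s' ->
  (forall u, u != s -> u != s' -> l u = ax u) ->
  wedge A (upd l s (ax s)) (tensor (y (ax s))) r =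
  - wedge A (upd l s (ax s')) (tensor (y (ax s'))) r.
Proof.
move=> sy l0 ne lax; apply/eqP; rewrite -addr_eq0 -(solution_wedge l s r sy).
rewrite (bigD1 (ax s)) //= (bigD1 (ax s')) /=; last by rewrite (inj_eq lift_inj) eq_sym.
rewrite big1 ?addr0 // => j /andP[js js'].
have [u ju lu] : exists2 u, u != s & l u = j.
  case: (unliftP ord0 j) js js' => [u ->|-> _ _]; last by exists s'; rewrite // eq_sym.
  by rewrite !(inj_eq lift_inj) => us us'; exists u => //; apply: lax.
apply: (@wedge_dup _ _ _ _ _ _ _ _ _ s u) => //; rewrite 1?eq_sym //.
by rewrite /upd eqxx (negPf ju).
Qed.

(** The same with all slots labelled in order: as in Cramer's rule, the contraction
    determines y_(s + 1) from y_0. *)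
Let cramer y s r : solution y ->
  wedge A ax (tensor (y (ax s))) r = - wedge A (upd ax s ord0) (tensor (y ord0)) r.
Proof.
move=> sy; apply/eqP; rewrite -addr_eq0 -(solution_wedge ax s r sy).
rewrite (bigD1 (ax s)) //= (bigD1 ord0) //= big1 ?addr0 //.
  rewrite (@eq_wedge _ _ _ _ _ A (upd ax s (ax s)) ax) // => u.
  by rewrite /upd; case: eqP => // ->.
move=> j /andP[js]; case: (unliftP ord0 j) js => [u ->|->]; rewrite ?eqxx //.
rewrite (inj_eq lift_inj) => us _.
apply: (@wedge_dup _ _ _ _ _ _ _ _ _ s u) => //; rewrite 1?eq_sym //.
by rewrite /upd eqxx (negPf us).
Qed.

Let solution_unique y : solution y -> y ord0 = 0 -> forall j, y j = 0.
Proof.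
move=> sy y0 j; case: (unliftP ord0 j) => [s ->|-> //]; apply: ndA => r.
by rewrite -/(ax s) cramer // y0 wedge0 oppr0.
Qed.

(** The part of the relation that involves y_1, .., y_(k + 1), as a map from
    families of k + 1 symmetric tensors; [rep] chooses an ordering of each multiset. *)
Let lowmap (rep : multiset a.+1 k -> {ffun 'I_k -> 'I_a.+1}) (Y : 'M[K]_(k.+1, N)) :
   'M[K]_(m, N') :=
  \matrix_(i, q) \sum_s \sum_c A (ax s) i c * Y s (class_index (ffcons c (rep (enum_val q)))).

Let lowmap_linear rep : linear (lowmap rep).
Proof.
move=> x Y Z; apply/matrixP => i q; rewrite !mxE mulr_sumr -big_split.
apply: eq_bigr => s _; rewrite mulr_sumr -big_split; apply: eq_bigr => c _ /=.
by rewrite !mxE; ring.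
Qed.

(** Source and target of [lowmap] have the same dimension, so that its injectivity,
    which is [solution_unique], makes it surjective. *)
Let dims : (k.+1 * N = m * N')%N.
Proof. by rewrite !card_multiset mE mul_bin_diag. Qed.

Lemma solution_exists (v : 'rV[K]_N) : exists y, solution y /\ y ord0 = v.
Proof.
have [rep repP] := fin_all_exists (@content_surj a.+1 k).
pose F : {linear 'M[K]_(k.+1, N) -> 'M[K]_(m, N')} :=
  HB.pack (lowmap rep) (GRing.isLinear.Build _ _ _ _ _ (lowmap_linear rep)).
pose fam (w : 'rV[K]_N) (Y : 'M[K]_(k.+1, N)) j := oapp (fun s => row s Y) w (unlift ord0 j).
have famP w Y : (forall i q, \sum_c A ord0 i c * tensor w (ffcons c (rep (enum_val q)))
     + F Y i q = 0) -> solution (fam w Y).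
  move=> h i u; rewrite big_ord_recl {1}/fam unlift_none /=.
  rewrite -[RHS](h i (enum_rank (content u))) /F /= mxE enum_rankK.
  have ec c : class_index (ffcons c u) = class_index (ffcons c (rep (content u))).
    by rewrite /class_index (content_cons c (esym (repP _))).
  congr (_ + _); first by apply: eq_bigr => c _; rewrite /tensor ec.
  apply: eq_bigr => s _; apply: eq_bigr => c _.
  by rewrite /fam liftK /= /tensor mxE ec.
have inj : row_free (lin_mx F).
  rewrite -kermx_eq0; apply/eqP/row_matrixP => i; rewrite row0.
  set u := row i _; have uF : u *m lin_mx F = 0 by rewrite -row_mul mulmx_ker row0.
  have FY : F (vec_mx u) = 0.
    by apply: (can_inj mxvecK); rewrite -mul_vec_lin vec_mxK uF linear0.
  rewrite -[u]vec_mxK; suff -> : vec_mx u = 0 by rewrite linear0.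
  have /solution_unique sol : solution (fam 0 (vec_mx u)).
    by apply: famP => i' q; rewrite FY mxE addr0 big1 // => c _; rewrite /tensor mxE mulr0.
  apply/row_matrixP => s; rewrite row0; have := sol _ (ax s).
  by rewrite /fam unlift_none liftK; apply.
have full : row_full (lin_mx F).
  by apply/eqP; rewrite (eqP inj); apply: dims.
pose b : 'M[K]_(m, N') :=
  - \matrix_(i, q) \sum_c A ord0 i c * tensor v (ffcons c (rep (enum_val q))).
have /submxP[u uE] : (mxvec b <= lin_mx F)%MS by apply: submx_full.
exists (fam v (vec_mx u)); split; last by rewrite /fam unlift_none.
apply: famP => i q.
have -> : F (vec_mx u) = b.
  by apply: (can_inj mxvecK); rewrite -mul_vec_lin vec_mxK uE.
by rewrite !mxE subrr.
Qed.

Lemma gamma_exists : exists G : 'I_k.+2 -> 'M[K]_N,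
  G ord0 = 1%:M /\ forall v, solution (fun j => v *m G j).
Proof.
have [y yP] := fin_all_exists (fun p : 'I_N => solution_exists (delta_mx 0 p)).
exists (fun j => \matrix_p y p j); split.
  apply/row_matrixP => p; rewrite rowK row1; by case: (yP p).
move=> v i u.
have tE j t : tensor (v *m \matrix_p y p j) t = \sum_p v 0 p * tensor (y p j) t.
  by rewrite /tensor mxE; apply: eq_bigr => p _; rewrite mxE.
under eq_bigr => j _ do under eq_bigr => c _ do rewrite tE mulr_sumr.
under eq_bigr => j _ do rewrite exchange_big /=.
rewrite exchange_big /=; apply: big1 => p _.
rewrite -[RHS](mulr0 (v 0 p)) -[in RHS]((yP p).1 i u) mulr_sumr.
apply: eq_bigr => j _; rewrite mulr_sumr; apply: eq_bigr => c _; ring.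
Qed.

(** Cramer's rule turns the two products, applied to v, into contractions of G_s v and
    G_s' v, where A_0 has replaced the matrix of slot s', respectively of slot s. An
    exchange of labels and then of slots identifies them, with signs that cancel. *)
Lemma gamma_commute (G : 'I_k.+2 -> 'M[K]_N) :
  G ord0 = 1%:M -> (forall v, solution (fun j => v *m G j)) ->
  forall i j, comm_mx (G i) (G j).
Proof.
move=> G0 Gs i j; case: (unliftP ord0 i) => [s ->|->]; last by rewrite G0; apply: comm1mx.
case: (unliftP ord0 j) => [s' ->|->]; last by rewrite G0; apply: comm_mx1.
have [->//|ne] := eqVneq s s'; rewrite -/(ax s) -/(ax s').
suff h (v : 'rV_N) : v *m (G (ax s) *m G (ax s')) = v *m (G (ax s') *m G (ax s)).
  by apply/row_matrixP => p; rewrite !rowE h.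
apply/eqP; rewrite -subr_eq0; apply/eqP/ndA => r.
rewrite wedgeD wedgeN !mulmxA; apply/eqP; rewrite subr_eq0; apply/eqP.
rewrite (@cramer (fun j => v *m G (ax s) *m G j)) //.
rewrite (@cramer (fun j => v *m G (ax s') *m G j)) // G0 !mulmx1; congr (- _).
have := @exchange (fun j => v *m G j) (upd ax s' ord0) s s' r (Gs v).
rewrite {1}/upd eqxx => /(_ erefl ne) h.
have lu u : u != s -> u != s' -> upd ax s' ord0 u = ax u.
  by rewrite /upd => _ /negPf->.
have {h lu} h := h lu.
rewrite (@eq_wedge _ _ _ _ _ A _ (upd ax s' ord0)) in h; last first.
  by move=> u; rewrite /upd; case: (u =P s) => // ->; rewrite (negPf ne).
rewrite h (@eq_wedge _ _ _ _ _ A _ (fun u => upd ax s ord0 (tperm s s' u))); last first.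
  move=> u; rewrite /upd; case: tpermP => [->|->|/eqP us /eqP us'].
  - by rewrite eqxx eq_sym (negPf ne).
  - by rewrite !eqxx eq_sym (negPf ne).
  - by rewrite (negPf us) (negPf us').
by rewrite wedge_permute // odd_tperm ne expr1 mulN1r opprK.
Qed.

(** For a common eigenvector v of the operators, with eigenvalues y_j, the relation
    sum_j A_j (y_j v) = 0 says that sum_j y_j A_j kills every slice of the tensor v
    in its first slot. *)
Lemma multiparameter_eigenvector (I : finType) (B : I -> I -> K) :
  anisotropic B -> odd 'C(m, k.+1) ->
  exists (L : fieldType) (g : {rmorphism K -> L}),
    anisotropic (fun i j => g (B i j)) /\
    exists (x : 'I_a.+1 -> L) (y : 'I_k.+2 -> L),
      [/\ exists c, x c != 0, y ord0 = 1 &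
          forall i, \sum_j \sum_c y j * (g (A j i c) * x c) = 0].
Proof.
move=> aB oN; have [G [G0 Gs]] := gamma_exists.
have oN' : odd N by rewrite card_multiset -mE.
have [|L [g [aL [v v0 vP]]]] := @odd_common_eigenvector _ _ _ _ (codom G) aB oN'.
  by move=> _ _ /codomP[i ->] /codomP[j ->]; apply: gamma_commute.
exists L, g; split=> //.
have [y yP] : exists y : 'I_k.+2 -> L, forall j, v *m map_mx g (G j) = y j *: v.
  suff h (j : 'I_k.+2) : exists z : L, v *m map_mx g (G j) = z *: v.
    exact: fin_all_exists h.
  have /eigenvectorP[z] := vP _ (codom_f G j).
  by move/eigenspaceP => e; exists z.
have /rV0Pn[p vp] := v0.
have [t tp] := content_surj (enum_val p).
pose t0 : 'I_k.+1 := ord0.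
exists (fun c => v 0 (class_index (slot t t0 c))), y; split.
- exists (t t0); suff -> : slot t t0 (t t0) = t by rewrite /class_index tp enum_valK.
  by apply/ffunP => u; rewrite ffunE /upd; case: eqP => // ->.
- have := yP ord0; rewrite G0 map_mx1 mulmx1 => /rowP/(_ p); rewrite mxE => /eqP.
  by rewrite -subr_eq0 -{1}[v 0 p]mul1r -mulrBl mulf_eq0 (negPf vp) orbF subr_eq0 => /eqP.
move=> i; have [u hu] := slot_permute t t0.
have yE j q : y j * v 0 q = \sum_p v 0 p * g (G j p q).
  have := yP j => /rowP/(_ q); rewrite !mxE => <-.
  by apply: eq_bigr => ? _; rewrite mxE.
have -> : \sum_j \sum_c y j * (g (A j i c) * v 0 (class_index (slot t t0 c))) =
   \sum_p v 0 p * g (\sum_j \sum_c A j i c * G j p (class_index (ffcons c u))).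
  transitivity (\sum_j \sum_c \sum_p v 0 p * g (A j i c * G j p (class_index (ffcons c u)))).
    apply: eq_bigr => j _; apply: eq_bigr => c _.
    rewrite mulrCA yE mulr_sumr; apply: eq_bigr => q _.
    by rewrite {1}/class_index hu -/(class_index _) rmorphM mulrCA.
  under eq_bigr => j _ do rewrite exchange_big /=.
  rewrite exchange_big /=; apply: eq_bigr => q _; rewrite rmorph_sum mulr_sumr.
  by apply: eq_bigr => j _; rewrite rmorph_sum mulr_sumr.
apply: big1 => q _; have := Gs (delta_mx 0 q) i u.
suff -> : \sum_j \sum_c A j i c * tensor (delta_mx 0 q *m G j) (ffcons c u) =
  \sum_j \sum_c A j i c * G j q (class_index (ffcons c u)).
  by move=> ->; rewrite rmorph0 mulr0.
by apply: eq_bigr => j _; apply: eq_bigr => c _; rewrite /tensor -rowE mxE.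
Qed.

End Multiparameter.

(** * Systems in general position *)

(** A choice of k rows for each p, with distinct sets of rows. Indexing them like a
    basis of the symmetric tensors will make the contraction a square matrix. *)
Lemma subset_family N k m : N = 'C(m, k) ->
  exists r : 'I_N -> 'I_k -> 'I_m, (forall p, injective (r p)) /\
    forall p q, p != q -> exists i, forall j, r q i != r p j.
Proof.
move=> NE; pose P := [set S : {set 'I_m} | #|S| == k].
have cP : N = #|P| by rewrite NE card_draws card_ord.
pose S p := enum_val (cast_ord cP p).
have cS p : k = #|S p| by have := enum_valP (cast_ord cP p); rewrite inE => /eqP.
exists (fun p i => enum_val (cast_ord (cS p) i)); split=> [p i j|p q pq].
  by move/enum_val_inj/cast_ord_inj.
have : ~~ (S q \subset S p).
  apply: contra pq => sub; have /eqP : S q == S p by rewrite eqEcard sub -!cS leqnn.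
  by move/enum_val_inj/cast_ord_inj->.
case/subsetPn => x xq xp; exists (cast_ord (esym (cS q)) (enum_rank_in xq x)) => j.
rewrite cast_ordKV enum_rankK_in //; apply: contraNneq xp => ->; exact: enum_valP.
Qed.

(** The matrix of the alternating contraction, restricted to the choices of rows
    given by r. *)
Section Compound.
Variables (k m a : nat).
Notation N := #|{: multiset a.+1 k}|.
Variable r : 'I_N -> 'I_k -> 'I_m.

Definition compound (R : comNzRingType) (A : 'I_k.+1 -> 'I_m -> 'I_a.+1 -> R) : 'M[R]_N :=
  \matrix_(p, q) \sum_(t | class_index t == p)
     \det (\matrix_(i, s) A (lift ord0 s) (r q i) (t s)).

Lemma wedge_compound (R : comNzRingType) (A : 'I_k.+1 -> 'I_m -> 'I_a.+1 -> R) v q :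
  wedge A (lift ord0) (tensor v) (r q) = (v *m compound A) 0 q.
Proof.
rewrite /wedge (partition_big (@class_index _ _) xpredT) //= mxE.
apply: eq_bigr => p _; rewrite mxE mulr_sumr; apply: eq_bigr => t /eqP tp.
by rewrite /tensor tp.
Qed.

Lemma compound_nondegenerate (K : fieldType) (A : 'I_k.+1 -> 'I_m -> 'I_a.+1 -> K) :
  \det (compound A) != 0 -> nondegenerate A.
Proof.
move=> d v v0; have u : compound A \in unitmx by rewrite unitmxE unitfE.
rewrite -[v](mulmxK u); suff -> : v *m compound A = 0 by rewrite mul0mx.
by apply/rowP => q; rewrite -wedge_compound v0 mxE.
Qed.

Lemma map_compound (R S : comNzRingType) (f : {rmorphism R -> S}) A :
  map_mx f (compound A) = compound (fun j i c => f (A j i c)).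
Proof.
apply/matrixP => p q; rewrite !mxE rmorph_sum; apply: eq_bigr => t _.
by rewrite -det_map_mx; congr (\det _); apply/matrixP => i s; rewrite !mxE.
Qed.

End Compound.

(** Identify x with the polynomial with coefficients x_c: for j > 0, the matrix A_j
    maps x to the values of x 'X^(j - 1) at the points tau. *)
Definition vandermonde_tensor (K : fieldType) k m a (tau : 'I_m -> K)
  (j : 'I_k.+1) (i : 'I_m) (c : 'I_a.+1) : K := tau i ^+ (j.-1 + c).

Lemma wedge_power (R : comNzRingType) (k m a b : nat) (A : 'I_b -> 'I_m -> 'I_a -> R)
   (f : 'I_a -> R) (l : 'I_k -> 'I_b) (r : 'I_k -> 'I_m) :
  wedge A l (fun t => \prod_s f (t s)) r =
  \det (\matrix_(i, s) \sum_c f c * A (l s) (r i) c).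
Proof.
rewrite /wedge -[RHS]det_tr; under eq_bigr => t _ do rewrite -det_tr.
rewrite /determinant; under eq_bigr => t _ do rewrite mulr_sumr.
rewrite exchange_big /=; apply: eq_bigr => p _.
under [in RHS]eq_bigr => i _ do rewrite !mxE.
rewrite bigA_distr_bigA mulr_sumr /=; apply: eq_bigr => t _.
rewrite mulrCA big_split /=; congr (_ * (_ * _)).
by apply: eq_bigr => s _; rewrite !mxE.
Qed.

Lemma eq_wedge_tensor (R : comNzRingType) (k m a b : nat) (A : 'I_b -> 'I_m -> 'I_a -> R)
   w w' (l : 'I_k -> 'I_b) r : w =1 w' -> wedge A l w r = wedge A l w' r.
Proof. by move=> e; apply: eq_bigr => t _; rewrite e. Qed.

Lemma tensor_power (R : comNzRingType) k a (f : 'I_a -> R) :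
  exists v : 'rV[R]_#|{: multiset a k}|, forall t, tensor v t = \prod_s f (t s).
Proof.
have [rep repP] := fin_all_exists (@content_surj a k).
exists (\row_q \prod_s f (rep (enum_val q) s)) => t.
rewrite /tensor mxE enum_rankK.
have /eqP := repP (content t); rewrite content_eq => e.
have prodE (u : {ffun 'I_k -> 'I_a}) : \prod_s f (u s) = \prod_(x <- map u (enum 'I_k)) f x.
  by rewrite big_map big_enum.
by rewrite !prodE (perm_big _ e).
Qed.

(** For a set p of k points, let v_p be the polynomial that vanishes at the
    other points. The contraction of v_p (x) .. (x) v_p is a Vandermonde determinant
    times the values of v_p at the chosen points, so it vanishes for all sets except
    p: these tensors bring the matrix to an invertible diagonal form. *)
Lemma compound_vandermonde (K : fieldType) k m a (tau : 'I_m -> K)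
   (r : 'I_#|{: multiset a.+1 k}| -> 'I_k -> 'I_m) :
  injective tau -> m = (k + a)%N ->
  (forall p : 'I_#|{: multiset a.+1 k}|, injective (r p)) ->
  (forall p q, p != q -> exists i, forall j, r q i != r p j) ->
  \det (compound r (@vandermonde_tensor K k m a tau)) != 0.
Proof.
move=> tau_inj mE r_inj r_diff.
pose v p : {poly K} := \prod_(x <- map tau (enum [predC codom (r p)])) ('X - x%:P).
have sv p : (size (v p) <= a.+1)%N.
  rewrite size_prod_XsubC size_map -cardE ltnS.
  have : (#|codom (r p)| + #|[predC codom (r p)]| = k + a)%N.
    by rewrite cardC card_ord mE.
  by rewrite (card_codom (@r_inj p)) card_ord => /addnI->.
have v0 p i : ((v p).[tau i] == 0) = (i \notin codom (r p)).
  by rewrite -rootE root_prod_XsubC mem_map // mem_enum.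
have [w wP] := fin_all_exists (fun p => tensor_power k (fun c : 'I_a.+1 => (v p)`_c)).
have detE p q : ((\matrix_p w p) *m compound r (@vandermonde_tensor K k m a tau)) p q =
   (\prod_i (v p).[tau (r q i)]) *
   \prod_(i < k) \prod_(j < k | (i < j)%N) (tau (r q j) - tau (r q i)).
  transitivity ((w p *m compound r (@vandermonde_tensor K k m a tau)) 0 q).
    by rewrite -[w p](rowK w p) -row_mul [RHS]mxE.
  rewrite -wedge_compound (eq_wedge_tensor _ _ _ (wP p)).
  rewrite (wedge_power _ (fun c : 'I_a.+1 => (v p)`_c)).
  have -> : \matrix_(i, s < k)
      (\sum_(c < a.+1) (v p)`_c * vandermonde_tensor tau (lift ord0 s) (r q i) c) =
    diag_mx (\row_i (v p).[tau (r q i)]) *m (Vandermonde k (\row_i tau (r q i)))^T.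
    apply/matrixP => i s; rewrite mul_diag_mx !mxE (horner_coef_wide _ (sv p)) mulr_suml.
    by apply: eq_bigr => c _; rewrite /vandermonde_tensor exprD; ring.
  rewrite det_mulmx det_diag det_tr det_Vandermonde; congr (_ * _).
    by apply: eq_bigr => i _; rewrite mxE.
  by apply: eq_bigr => i _; apply: eq_bigr => j _; rewrite !mxE.
set D := compound _ _ in detE *.
suff : \det ((\matrix_p w p) *m D) != 0.
  by rewrite det_mulmx mulf_eq0 negb_or => /andP[].
have -> : (\matrix_p w p) *m D = diag_mx (\row_p ((\matrix_p w p) *m D) p p).
  apply/matrixP => p q; rewrite [RHS]mxE [X in _ = X *+ _]mxE.
  have [<-|/r_diff[i ri]] := eqVneq p q; first by rewrite mulr1n.
  rewrite mulr0n detE.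
  rewrite (bigD1 i) //= (_ : (v p).[_] = 0) ?mul0r //.
  by apply/eqP; rewrite v0; apply/codomP => -[j e]; have := ri j; rewrite e eqxx.
rewrite det_diag; apply/prodf_neq0 => p _; rewrite mxE detE mulf_neq0 //.
  by apply/prodf_neq0 => i _; rewrite v0 negbK codom_f.
apply/prodf_neq0 => i _; apply/prodf_neq0 => j ij.
by rewrite subr_eq0 !(inj_eq tau_inj, inj_eq (@r_inj p)) neq_ltn ij orbT.
Qed.

(** The determinant is a polynomial in the variable, and its value at 0 is the
    determinant for the Vandermonde system. *)
Lemma generic_nondegenerate (K : fieldType) k m a (A : 'I_k.+1 -> 'I_m -> 'I_a.+1 -> K)
   (tau : 'I_m -> K) : injective tau -> m = (k + a)%N ->
  nondegenerate (fun j i c =>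
    rvar K * rconst K (A j i c) + rconst K (vandermonde_tensor tau j i c)).
Proof.
move=> tau_inj mE.
have NE : #|{: multiset a.+1 k}| = 'C(m, k) by rewrite card_multiset mE.
have [r [r_inj r_diff]] := subset_family NE.
apply: (@compound_nondegenerate k m a r).
pose P j i c : {poly K} := 'X * (A j i c)%:P + (vandermonde_tensor tau j i c)%:P.
have -> : compound r (fun j i c => 
    rvar K * rconst K (A j i c) + rconst K (vandermonde_tensor tau j i c)) =
  map_mx (@tofrac _) (compound r P).
  rewrite map_compound; apply/matrixP => p q; rewrite !mxE; apply: eq_bigr => t _.
  by congr (\det _); apply/matrixP => i s; rewrite !mxE /P rmorphD rmorphM.
rewrite det_map_mx tofrac_eq0.
apply: contraTneq (compound_vandermonde tau_inj mE r_inj r_diff) => d0.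
rewrite negbK; have := congr1 (horner_eval 0) d0.
rewrite -det_map_mx map_compound /horner_eval horner0 => <-; apply/eqP; congr (\det _).
apply/matrixP => p q; rewrite !mxE; apply: eq_bigr => t _.
by congr (\det _); apply/matrixP => i s; rewrite !mxE /= /horner_eval /P !hornerE.
Qed.

(** * Parity of the number of common zeros *)

Lemma rvar_powers_inj (K : fieldType) (m : nat) : injective (fun i : 'I_m => rvar K ^+ i).
Proof.
move=> i j /eqP; rewrite /rvar -!rmorphXn tofrac_eq /= => /eqP /(congr1 (size \o val)).
by rewrite /= !size_polyXn => -[] /val_inj.
Qed.

Lemma anisotropic_ratfun (K : fieldType) (I : finType) (B : I -> I -> K) :
  anisotropic B -> anisotropic (fun i j => rconst K (B i j)).
Proof.
move=> aB x qx; refine (@anisotropic_pencil K I B (fun _ _ => 0) aB x _).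
transitivity (rvar K * qform (fun i j => rconst K (B i j)) x); last by rewrite qx mulr0.
rewrite /qform mulr_sumr; apply: eq_bigr => i _; rewrite mulr_sumr.
by apply: eq_bigr => j _; rewrite rmorph0 addr0 !mulrA.
Qed.

Definition pairing (R : comNzRingType) (I : finType) (u x : I -> R) : R := \sum_i u i * x i.

Definition segre (R : comNzRingType) (I J : finType) (x : I -> R) (y : J -> R) : I * J -> R :=
  fun p => x p.1 * y p.2.

Lemma pairing_segre (R : comNzRingType) (I J : finType) (u : I * J -> R) x y :
  pairing u (segre x y) = \sum_j \sum_i y j * (u (i, j) * x i).
Proof.
rewrite exchange_big pair_bigA; apply: eq_bigr => -[i j] _ /=.
by rewrite /segre /=; ring.
Qed.

Lemma qform_add_products (R : comNzRingType) (I J : finType) t (B : I -> I -> R)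
   (u v : J -> I -> R) x :
  qform (fun p q => t * B p q + \sum_j u j p * v j q) x =
  t * qform B x + \sum_j pairing (u j) x * pairing (v j) x.
Proof.
under [X in _ = _ + X]eq_bigr => i _ do rewrite /pairing mulr_suml.
rewrite [X in _ = _ + X]exchange_big /qform mulr_sumr -big_split /=.
apply: eq_bigr => p _.
under [X in _ = _ + X]eq_bigr => i _ do rewrite mulr_sumr.
rewrite [X in _ = _ + X]exchange_big mulr_sumr -big_split /=; apply: eq_bigr => q _.
rewrite !mulrDl -!mulrA mulr_suml; congr (_ + _); apply: eq_bigr => i _; ring.
Qed.

(** Quantifying over all extensions makes this an identity of polynomials, even when
    K is finite. *)
Definition factors_on_segre (K : fieldType) (I J : finType) m (B : I * J -> I * J -> K)
    (U V : 'I_m -> I * J -> K) : Prop :=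
  forall (L : fieldType) (g : {rmorphism K -> L}) x y,
    qform (fun p q => g (B p q)) (segre x y) =
    \sum_i pairing (fun p => g (U i p)) (segre x y) *
           pairing (fun p => g (V i p)) (segre x y).

(** The perturbed system has a solution over an extension L where the perturbed form
    is anisotropic, although the form vanishes there. *)
Lemma even_intersection_aux (K : fieldType) (a k : nat)
  (B : 'I_a.+1 * 'I_k.+2 -> 'I_a.+1 * 'I_k.+2 -> K)
  (U V : 'I_(k.+1 + a) -> 'I_a.+1 * 'I_k.+2 -> K) (tau : 'I_(k.+1 + a) -> K) :
  injective tau -> 2%:R != 0 :> K -> anisotropic B -> factors_on_segre B U V ->
  ~~ odd 'C(k.+1 + a, k.+1).
Proof.
move=> tau_inj two aB factor; apply/negP => oN.
pose G (j : 'I_k.+2) (i : 'I_(k.+1 + a)) (c : 'I_a.+1) : K := vandermonde_tensor tau j i c.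
have nd := @generic_nondegenerate K k.+1 (k.+1 + a) a
  (fun j i c => U i (c, j)) tau tau_inj erefl.
have aK2 := anisotropic_pencil (C := fun p q => \sum_i G p.2 i p.1 * V i q) aB.
have two2 : 2%:R != 0 :> ratfun K by rewrite -(rmorph_nat (rconst K)) fmorph_eq0.
have [L [g [aL [x [y [[c xc] y0 sol]]]]]] :=
  multiparameter_eigenvector two2 erefl nd aK2 oN.
(* From here on only T and the embedding f of K matter, not how their field is built. *)
move: nd aK2 two2 aL sol; rewrite -/G; move: (rvar K) (rconst K) g => T f g _ _ _ aL sol.
pose h : {rmorphism K -> L} := g \o f.
have fE := factor L h x y.
suff /aL/(_ (c, ord0))/eqP :
    qform (fun p q => g (T * f (B p q) + f (\sum_i G p.2 i p.1 * V i q))) (segre x y) = 0.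
  by rewrite /segre y0 mulr1 (negPf xc).
have hE z : g (f z) = h z by [].
have {}sol i : \sum_j \sum_c y j * ((g T * h (U i (c, j)) + h (G j i c)) * x c) = 0.
  rewrite -[RHS](sol i); apply: eq_bigr => j _; apply: eq_bigr => c' _.
  by rewrite rmorphD rmorphM /= !hE.
rewrite (@eq_qform_coef _ _ _
  (fun p q => g T * h (B p q) + \sum_i h (G p.2 i p.1) * h (V i q))).
  rewrite (qform_add_products _ _ (fun i p => h (G p.2 i p.1)) (fun i p => h (V i p))).
  rewrite fE; move: (g T) (h : K -> L) sol => gT h' sol.
  rewrite mulr_sumr -big_split big1 //= => i _.
  rewrite mulrA -mulrDl -[RHS](mul0r (pairing (fun p => h' (V i p)) (segre x y))).
  congr (_ * _).
  rewrite -[RHS](sol i) !pairing_segre mulr_sumr -big_split; apply: eq_bigr => j _.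
  rewrite mulr_sumr -big_split; apply: eq_bigr => c' _ /=; ring.
move=> p q; rewrite rmorphD rmorphM /= !hE rmorph_sum; congr (_ + _).
by apply: eq_bigr => i _; rewrite rmorphM.
Qed.

(** For b = 0 the system is linear and has a zero over K itself; otherwise a first
    transcendental extension provides the distinct points for the perturbation. *)
Lemma even_intersection (K : fieldType) (a b : nat)
  (B : 'I_a.+1 * 'I_b.+1 -> 'I_a.+1 * 'I_b.+1 -> K)
  (U V : 'I_(b + a) -> 'I_a.+1 * 'I_b.+1 -> K) :
  2%:R != 0 :> K -> anisotropic B -> factors_on_segre B U V ->
  ~~ odd 'C(b + a, b).
Proof.
move=> two aB factor; case: b => [|k] in B U V aB factor *.
  pose M := \matrix_(c < a.+1, i < 0 + a) U i (c, ord0).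
  have : kermx M != 0.
    by rewrite kermx_eq0 /row_free neq_ltn ltnS rank_leq_col.
  case/rowV0Pn => x /sub_kermxP xM /rV0Pn[c xc].
  suff /aB/(_ (c, ord0))/eqP : qform B (segre (x 0) (fun=> 1)) = 0.
    by rewrite /segre mulr1 (negPf xc).
  rewrite (factor K idfun) big1 // => i _.
  rewrite pairing_segre big_ord1 (_ : \sum_i0 _ = 0) ?mul0r //.
  have /rowP/(_ i) := xM; rewrite !mxE => e; apply: etrans e.
  by apply: eq_bigr => j _; rewrite mxE mul1r mulrC.
apply: (@even_intersection_aux _ _ _ _ (fun i p => rconst K (U i p))
   (fun i p => rconst K (V i p)) _ (@rvar_powers_inj K (k.+1 + a)) _ (anisotropic_ratfun aB)).
  by rewrite -(rmorph_nat (rconst K)) fmorph_eq0.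
by move=> L g x y; have := factor L (g \o rconst K) x y.
Qed.

(** * Generic anisotropic forms *)

Definition diag_form (R : comNzRingType) (I : finType) (d : I -> R) (i j : I) : R :=
  d i *+ (i == j).

Lemma qform_diag (R : comNzRingType) (I : finType) (d : I -> R) x :
  qform (diag_form d) x = \sum_i d i * x i ^+ 2.
Proof.
apply: eq_bigr => i _; rewrite (bigD1 i) //= big1 => [|j ji].
  by rewrite /diag_form eqxx mulr1n addr0 expr2 mulrA.
by rewrite /diag_form eq_sym (negPf ji) mulr0n !mul0r.
Qed.

(** Vectors are extended by zero, here as a sum over the fibre of f. *)
Lemma anisotropic_inj (K : fieldType) (I J : finType) (B : I -> I -> K) (f : J -> I) :
  injective f -> anisotropic B -> anisotropic (fun i j => B (f i) (f j)).
Proof.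
move=> f_inj aB x qx j.
pose x' i := \sum_(j | f j == i) x j.
have sumE (h : I -> K) : \sum_i h i * x' i = \sum_j h (f j) * x j.
  under eq_bigr => i _ do rewrite mulr_sumr.
  rewrite (exchange_big_dep xpredT) //=; apply: eq_bigr => j' _.
  by rewrite (eq_bigl (pred1 (f j'))) ?big_pred1_eq // => i /=; rewrite eq_sym.
have : x' (f j) = 0.
  apply: aB; apply: etrans qx; rewrite /qform.
  under eq_bigr => i _ do rewrite sumE.
  rewrite exchange_big /= [RHS]exchange_big; apply: eq_bigr => j' _ /=.
  under eq_bigr => i _ do rewrite mulrAC.
  by rewrite sumE; apply: eq_bigr => i' _; rewrite mulrAC.
by move=> <-; rewrite /x' (eq_bigl (pred1 j)) ?big_pred1_eq // => i /=; rewrite (inj_eq f_inj).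
Qed.

Lemma eq_anisotropic (K : fieldType) (I : finType) (B C : I -> I -> K) :
  (forall i j, B i j = C i j) -> anisotropic B -> anisotropic C.
Proof.
move=> e aB x qx; apply: aB; rewrite -qx.
by apply: eq_bigr => i _; apply: eq_bigr => j _; rewrite e.
Qed.

Lemma prod_set_recl (K L : fieldType) (f : {rmorphism K -> L}) z M (t : 'I_M -> K)
    (T : {set 'I_M.+1}) :
  \prod_(i in T) oapp (f \o t) z (unlift ord0 i) =
  (if ord0 \in T then z else 1) * f (\prod_(i in [set i | lift ord0 i \in T]) t i).
Proof.
rewrite big_mkcond big_ord_recl /= unlift_none; congr (_ * _).
rewrite rmorph_prod [RHS]big_mkcond; apply: eq_bigr => i _ /=.
by rewrite inE liftK.
Qed.

(** The generic Pfister form in M variables, whose coefficients are all the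
    square-free monomials: a new variable T turns phi into phi + T phi, the second
    copy standing for the subsets that contain the new index. *)
Lemma generic_pfister (F : fieldType) M : exists (K : fieldType) (f : {rmorphism F -> K})
  (t : 'I_M -> K), anisotropic (diag_form (fun S : {set 'I_M} => \prod_(i in S) t i)).
Proof.
elim: M => [|M [K [f [t aK]]]].
  exists F, idfun, (fun=> 1) => x; rewrite qform_diag => q i.
  have S0 (S : {set 'I_0}) : S = set0 by apply/setP => -[].
  move: q; rewrite (big_pred1 set0) => [|S]; last by rewrite (S0 S) /= eqxx.
  by rewrite big1 // mul1r (S0 i) => /eqP; rewrite expf_eq0 => /eqP.
exists (ratfun K), (rconst K \o f), (fun i => oapp (rconst K \o t) (rvar K) (unlift ord0 i)).
pose tl (S : {set 'I_M.+1}) := [set i | lift ord0 i \in S].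
pose phi (S : {set 'I_M.+1}) : {set 'I_M} + {set 'I_M} :=
  if ord0 \in S then inr (tl S) else inl (tl S).
(* A set is determined by its trace on the old indices and by whether it
   contains the new one. *)
have phi_inj : injective phi.
  have tlE S S' : tl S = tl S' -> (ord0 \in S) = (ord0 \in S') -> S = S'.
    move=> /setP e e0; apply/setP => i; case: (unliftP ord0 i) => [j|] -> //.
    by have := e j; rewrite !inE.
  move=> S S'; rewrite /phi; case: ifP; case: ifP => // h h' [e];
    by apply: tlE; rewrite // h h'.
apply: eq_anisotropic (anisotropic_inj phi_inj (anisotropic_sum aK aK)) => S S'.
have dE := prod_set_recl (rconst K) (rvar K) t.
rewrite /diag_form !dE -(inj_eq phi_inj).
rewrite /phi; case: ifP => h; case: ifP => h' //=.
- by rewrite -mulrnAr; congr (_ * _); apply: (rmorphMn (rconst K)).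
- by rewrite mul1r; apply: (rmorphMn (rconst K)).
Qed.

Lemma sqrt_minus_one (F : fieldType) :
  exists (K : fieldType) (f : {rmorphism F -> K}) (z : K), z ^+ 2 = -1.
Proof.
have sX : size ('X^2 + 1%:P : {poly F}) = 3.
  by rewrite size_polyDl size_polyXn // size_polyC oner_eq0.
have [[z rz]|nr] := classic (exists z, root ('X^2 + 1%:P : {poly F}) z).
  by exists F, idfun, z; move: rz; rewrite rootE !hornerE addr_eq0 => /eqP.
have irr : irreducible_poly ('X^2 + 1%:P : {poly F}).
  apply: cubic_irreducible; first by rewrite sX.
  by move=> x; apply/negP => rx; apply: nr; exists x.
have [L _ [z rz _]] := irredp_FAdjoin irr; exists L, (in_alg L), z.
move: rz; rewrite rootE rmorphD /= map_polyXn map_polyC /= !hornerE addr_eq0 => /eqP->.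
by rewrite ?scale1r.
Qed.

(** * Parity of binomial coefficients and evaluation of the formula *)

(** Lucas' theorem modulo 2, for the last binary digit. *)
Lemma odd_bin_double m : forall i,
  odd 'C(m.*2, i.*2) = odd 'C(m, i) /\ ~~ odd 'C(m.*2, i.*2.+1).
Proof.
elim: m => [|m IH] [|i]; rewrite ?double0 ?bin0 //.
  by rewrite bin1 odd_double.
rewrite !doubleS !binS !oddD.
have [e1 o1] := IH i; have [e2 o2] := IH i.+1; rewrite doubleS in e2 o2.
by rewrite e1 e2 (negPf o1) (negPf o2); case: (odd 'C(m, i)); case: (odd 'C(m, i.+1)).
Qed.

Lemma odd_bin_half n i : odd 'C(n, i) -> (odd i <= odd n)%N /\ odd 'C(n./2, i./2).
Proof.
rewrite -{1}(odd_double_half n) -{1}(odd_double_half i).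
have [e o] := odd_bin_double n./2 i./2.
case: (odd i); case: (odd n); rewrite ?add0n ?add1n; rewrite ?e ?(negPf o) //.
- by rewrite binS oddD e (negPf o).
- case: i./2 e o => [|j]; first by rewrite !bin0.
  move=> e o; rewrite doubleS binS oddD -doubleS e.
  by have [_ /negPf->] := odd_bin_double n./2 j; rewrite addbF.
Qed.

Lemma evaluate_formula (F L : fieldType) (g : {rmorphism F -> L}) r s n
    (c : 'I_n -> 'M[F]_(r, s)) (X : 'I_r -> L) (Y : 'I_s -> L) :
  (\sum_(j < r) xvar F s j ^+ 2) * (\sum_(k < s) yvar F r k ^+ 2)
    = \sum_(i < n) bilinear_expr (c i) ^+ 2 ->
  (\sum_j X j ^+ 2) * (\sum_k Y k ^+ 2) =
  \sum_i (\sum_j \sum_k g (c i j k) * (X j * Y k)) ^+ 2.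
Proof.
pose v (i : 'I_(r + s)) := match split i with inl j => X j | inr k => Y k end.
pose ev : {rmorphism {mpoly F[r + s]} -> L} := meval v \o map_mpoly g.
have evx j : ev (xvar F s j) = X j.
  by rewrite /ev /= /xvar map_mpolyX mevalXU /v -[lshift _ _]/(unsplit (inl _)) unsplitK.
have evy k : ev (yvar F r k) = Y k.
  by rewrite /ev /= /yvar map_mpolyX mevalXU /v -[rshift _ _]/(unsplit (inr _)) unsplitK.
move/(congr1 ev); rewrite rmorphM !rmorph_sum.
have sqx : \sum_j ev (xvar F s j ^+ 2) = \sum_j X j ^+ 2.
  by apply: eq_bigr => j _; rewrite rmorphXn evx.
have sqy : \sum_k ev (yvar F r k ^+ 2) = \sum_k Y k ^+ 2.
  by apply: eq_bigr => k _; rewrite rmorphXn evy.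
rewrite sqx sqy => ->; apply: eq_bigr => i _; rewrite rmorphXn; congr (_ ^+ 2).
rewrite /bilinear_expr rmorph_sum; apply: eq_bigr => j _.
rewrite rmorph_sum; apply: eq_bigr => k _.
have evZ a p : ev (a *: p) = g a * ev p by rewrite /ev /= map_mpolyZ mevalZ.
by rewrite evZ rmorphM evx evy.
Qed.

(** * Hyperbolic planes *)

Section Hyperbolic.
Variables (K : fieldType) (iota : K).
Hypotheses (two : 2%:R != 0 :> K) (iota2 : iota ^+ 2 = -1).

(** In the plane of the coordinates 2c and 2c + 1, the norm of (x, iota y) is
    (x - y)(x + y), which is d_c for x - y = 1 and x + y = d_c. If d_c = 1 then y = 0, and
    the vector fits in the coordinate 2c alone. *)
Definition orthogonal_vector r a (d : 'I_a -> K) (c : 'I_a) (j : 'I_r) : K :=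
  if val j == c.*2 then (d c + 1) / 2 else
  if val j == c.*2.+1 then iota * ((d c - 1) / 2) else 0.

Lemma orthogonal_vectorP r a (d : 'I_a -> K) :
  (forall c : 'I_a, (c.*2 < r)%N /\ ((c.*2.+1 < r)%N \/ d c = 1)) ->
  forall c c', \sum_(j < r) orthogonal_vector d c j * orthogonal_vector d c' j = d c *+ (c == c').
Proof.
move=> hd c c'; have [<-|ne] := eqVneq c c'; last first.
  apply: big1 => j _; rewrite /orthogonal_vector.
  have ne' : c != c' :> nat by [].
  by do 4?[case: eqP => ?]; rewrite ?mul0r ?mulr0 //; exfalso; lia.
have [lt0 lt1] := hd c; rewrite mulr1n (bigD1 (Ordinal lt0)) //=.
rewrite {1 2}/orthogonal_vector /= eqxx.
have e1 (x : K) : (x + 1) / 2 * ((x + 1) / 2) + (iota * ((x - 1) / 2)) ^+ 2 = x.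
  by rewrite exprMn iota2; field.
have [lt2|ge2] := ltnP c.*2.+1 r.
  rewrite (bigD1 (Ordinal lt2)) /=; last by rewrite -val_eqE /= neq_ltn leqnn orbT.
  rewrite big1 ?addr0; last first.
    move=> j /andP[]; rewrite -!val_eqE /orthogonal_vector /= => /negPf-> /negPf->.
    by rewrite mul0r.
  have n1 : (c.*2.+1 == c.*2) = false by apply/eqP; lia.
  by rewrite /orthogonal_vector /= n1 eqxx -[X in _ + X]expr2 e1.
case: lt1 => [|d1]; first by rewrite ltnNge ge2.
rewrite big1 ?addr0 => [|j]; first by rewrite d1; field.
rewrite -val_eqE /orthogonal_vector /= => /negPf->; case: eqP => [e|_]; last by rewrite mul0r.
by have := ltn_ord j; rewrite e ltnNge ge2.
Qed.

Lemma norm_orthogonal_combination (L : fieldType) (g : {rmorphism K -> L}) r a (d : 'I_a -> K)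
    (x : 'I_a -> L) :
  (forall c : 'I_a, (c.*2 < r)%N /\ ((c.*2.+1 < r)%N \/ d c = 1)) ->
  \sum_(j < r) (\sum_c x c * g (orthogonal_vector d c j)) ^+ 2 = \sum_c g (d c) * x c ^+ 2.
Proof.
move=> /orthogonal_vectorP hd.
under eq_bigr => j _ do rewrite expr2 mulr_suml.
rewrite exchange_big; apply: eq_bigr => c _ /=.
under eq_bigr => j _ do rewrite mulr_sumr.
rewrite exchange_big /= (bigD1 c) //= [X in _ + X]big1 ?addr0 => [|c' nc].
  have -> : g (d c) = g (\sum_(j < r) orthogonal_vector d c j * orthogonal_vector d c j).
    by rewrite hd eqxx mulr1n.
  rewrite rmorph_sum mulr_suml.
  by apply: eq_bigr => j _; rewrite rmorphM; ring.
transitivity (x c * x c' * g (d c *+ (c == c'))).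
  rewrite -hd rmorph_sum mulr_sumr; apply: eq_bigr => j _; rewrite rmorphM; ring.
by rewrite eq_sym (negPf nc) mulr0n rmorph0 mulr0.
Qed.

Lemma sum_of_squares_hyperbolic m (Z : nat -> K) :
  \sum_(i < m.*2.+1) Z i ^+ 2 =
  \sum_(i < m) (Z i.*2 + iota * Z i.*2.+1) * (Z i.*2 - iota * Z i.*2.+1) + Z m.*2 ^+ 2.
Proof.
elim: m => [|m IH]; first by rewrite big_ord1 big_ord0 add0r.
rewrite doubleS big_ord_recr big_ord_recr /= IH big_ord_recr /=; congr (_ + _).
rewrite -addrA; congr (_ + _).
transitivity (Z m.*2 ^+ 2 - iota ^+ 2 * Z m.*2.+1 ^+ 2); last by ring.
by rewrite iota2; ring.
Qed.

End Hyperbolic.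

(** * From formulas to anisotropic forms *)

(** The variables are indexed by 'I_(a.+1 + b.+1), and the norms of the orthogonal
    vectors are the monomials of the sets [marker_l c] and [marker_r c]. The flag ea (or
    eb) says whether the last vector has a variable norm, or norm 1 and the empty set,
    for lack of a second coordinate. *)
Section Markers.
Variables (a b : nat) (ea eb : bool).

Definition marked k (e : bool) (c : 'I_k.+1) := (c != ord_max) || e.

Lemma marked_eq k e (c c' : 'I_k.+1) :
  (forall u, (u == c) && marked e c = (u == c') && marked e c') -> c = c'.
Proof.
move=> h; apply/eqP/idPn => nc; have := h c; have := h c'.
rewrite !eqxx [c' == c]eq_sym (negPf nc) /= => /esym/negbT.
rewrite negb_or negbK => /andP[/eqP c'E _] /negbT; rewrite negb_or negbK => /andP[/eqP cE _].
by rewrite cE c'E eqxx in nc.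
Qed.

Definition marker_l (c : 'I_a.+1) : {set 'I_(a.+1 + b.+1)} :=
  if marked ea c then [set lshift b.+1 c] else set0.
Definition marker_r (c : 'I_b.+1) : {set 'I_(a.+1 + b.+1)} :=
  if marked eb c then [set rshift a.+1 c] else set0.
Definition marker (p : 'I_a.+1 * 'I_b.+1) := marker_l p.1 :|: marker_r p.2.

Lemma mem_marker_lshift p c : (lshift b.+1 c \in marker p) = (c == p.1) && marked ea p.1.
Proof.
rewrite inE /marker_l /marker_r; case: (marked ea _); case: (marked eb _);
  by rewrite !inE ?eq_lshift ?eq_lrshift ?andbT ?andbF ?orbF.
Qed.

Lemma mem_marker_rshift p c : (rshift a.+1 c \in marker p) = (c == p.2) && marked eb p.2.
Proof.
rewrite inE /marker_l /marker_r; case: (marked ea _); case: (marked eb _);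
  by rewrite !inE ?eq_rshift ?eq_rlshift ?andbT ?andbF ?orbF.
Qed.

Lemma marker_inj : injective marker.
Proof.
move=> [c d] [c' d'] e; congr (_, _).
  apply: (@marked_eq _ ea) => u.
  by have := mem_marker_lshift (c, d) u; rewrite e mem_marker_lshift.
apply: (@marked_eq _ eb) => u.
by have := mem_marker_rshift (c, d) u; rewrite e mem_marker_rshift.
Qed.

Lemma marker_neq0 p : ea || eb -> marker p != set0.
Proof.
case/orP => h; apply/set0Pn.
  by exists (lshift _ p.1); rewrite mem_marker_lshift eqxx /marked h orbT.
by exists (rshift _ p.2); rewrite mem_marker_rshift eqxx /marked h orbT.
Qed.

Lemma prod_marker (K : fieldType) (t : 'I_(a.+1 + b.+1) -> K) p :
  \prod_(i in marker p) t i = (\prod_(i in marker_l p.1) t i) * \prod_(i in marker_r p.2) t i.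
Proof.
rewrite -bigU /=; first by apply: eq_bigl => i; rewrite !inE.
rewrite disjoints_subset; apply/subsetP => u.
rewrite /marker_l /marker_r; case: ifP => _; last by rewrite inE.
by case: ifP => _; rewrite !inE // => /eqP->; rewrite eq_lrshift.
Qed.

End Markers.

(** As iota^2 = -1, the form is a sum of the squares of the entries of X, with the
    monomials of their markers, and of iota w (X), with coefficient 1, the monomial
    of the empty set. These sets are distinct, so this is part of the generic Pfister
    form. *)
Lemma anisotropic_markers (K : fieldType) (iota : K) a b ea eb
    (t : 'I_(a.+1 + b.+1) -> K) (W : 'I_a.+1 * 'I_b.+1 -> K) :
  iota ^+ 2 = -1 ->
  anisotropic (diag_form (fun S : {set 'I_(a.+1 + b.+1)} => \prod_(i in S) t i)) ->
  (forall p, W p = 0) \/ ea || eb ->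
  anisotropic (fun p q =>
    diag_form (fun p => \prod_(i in marker ea eb p) t i) p q - W p * W q).
Proof.
move=> iota2 aK hW.
have qE x :
   qform (fun p q => diag_form (fun p => \prod_(i in marker ea eb p) t i) p q - W p * W q) x =
   \sum_p (\prod_(i in marker ea eb p) t i) * x p ^+ 2 + (iota * pairing W x) ^+ 2.
  rewrite -qform_diag exprMn iota2 mulN1r expr2 /pairing mulr_suml -sumrN -big_split.
  apply: eq_bigr => p _ /=; rewrite mulr_sumr -sumrN -big_split.
  apply: eq_bigr => q _ /=; ring.
case: hW => [W0|e].
  apply: eq_anisotropic (anisotropic_inj (@marker_inj a b ea eb) aK) => p q.
  by rewrite W0 mul0r subr0 /diag_form (inj_eq (@marker_inj a b ea eb)).
pose phi (o : option ('I_a.+1 * 'I_b.+1)) := oapp (marker ea eb) set0 o.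
have phi_inj : injective phi.
  move=> [p|] [q|] //=; first by move/marker_inj->.
    by move=> h; have := marker_neq0 p e; rewrite h eqxx.
  by move=> h; have := marker_neq0 q e; rewrite -h eqxx.
move=> x; rewrite qE => q0 p.
refine (anisotropic_inj phi_inj aK (x := fun o => oapp x (iota * pairing W x) o) _ (Some p)).
transitivity (qform (diag_form (fun o => \prod_(i in phi o) t i))
  (fun o => oapp x (iota * pairing W x) o)).
  by apply: eq_qform_coef => o o'; rewrite /diag_form (inj_eq phi_inj).
rewrite qform_diag -[RHS]q0.
rewrite (bigD1 None) //= big_set0 mul1r addrC; congr (_ + _).
rewrite (reindex_onto Some (odflt p)) /=; last by case.
by apply: eq_bigl => q; rewrite eqxx.
Qed.

(** Where the plane of the last vector is cut off, its norm is 1. *)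
Lemma weight_condition (K : fieldType) (k N r : nat) (g : 'I_k.+1 -> 'I_N) (t : 'I_N -> K) :
  (k.*2 < r)%N -> forall c : 'I_k.+1, (c.*2 < r)%N /\ ((c.*2.+1 < r)%N \/
    \prod_(i in if marked (k.*2.+1 < r)%N c then [set g c] else set0) t i = 1).
Proof.
move=> kr c; have := ltn_ord c; rewrite ltnS => ck; split; first by lia.
rewrite /marked; have [-> /=|nc] := eqVneq c ord_max.
  by case: ifP => [h|_]; [left | right; rewrite big_set0].
by left; have : c != k :> nat by []; lia.
Qed.

(** The bilinear forms z_i, restricted to combinations of the orthogonal vectors,
    are linear forms in x (x) y. They are paired into hyperbolic planes, after extending
    them by 0: for even n the unpaired form W has index n and vanishes. *)
Lemma factors_formula (F K : fieldType) (f : {rmorphism F -> K}) (iota : K) r s n a b m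
    (c : 'I_n -> 'M[F]_(r, s)) (d1 : 'I_a.+1 -> K) (d2 : 'I_b.+1 -> K) :
  2%:R != 0 :> K -> iota ^+ 2 = -1 -> n = (odd n + m.*2)%N ->
  (forall c : 'I_a.+1, (c.*2 < r)%N /\ ((c.*2.+1 < r)%N \/ d1 c = 1)) ->
  (forall c : 'I_b.+1, (c.*2 < s)%N /\ ((c.*2.+1 < s)%N \/ d2 c = 1)) ->
  (\sum_(j < r) xvar F s j ^+ 2) * (\sum_(k < s) yvar F r k ^+ 2)
    = \sum_(i < n) bilinear_expr (c i) ^+ 2 ->
  exists (U V : 'I_m -> 'I_a.+1 * 'I_b.+1 -> K) (W : 'I_a.+1 * 'I_b.+1 -> K),
    factors_on_segre (fun p q => diag_form (fun p => d1 p.1 * d2 p.2) p q - W p * W q) U V /\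
    (~~ odd n -> forall p, W p = 0).
Proof.
move=> two iota2 nE h1 h2 formula.
pose z (i : 'I_n) (p : 'I_a.+1 * 'I_b.+1) : K :=
  \sum_j \sum_k f (c i j k) * (orthogonal_vector iota d1 p.1 j * orthogonal_vector iota d2 p.2 k).
pose Z i p := oapp (z^~ p) 0 (insub i).
have Zout i : (n <= i)%N -> forall p, Z i p = 0.
  by move=> ni p; rewrite /Z insubF // ltnNge ni.
exists (fun i p => Z i.*2 p + iota * Z i.*2.+1 p).
exists (fun i p => Z i.*2 p - iota * Z i.*2.+1 p), (Z m.*2).
split; last by move=> on p; apply: Zout; rewrite {1}nE (negPf on).
move=> L g x y.
pose zeta i := pairing (fun p => g (Z i p)) (segre x y).
have giota2 : g iota ^+ 2 = -1 by rewrite -rmorphXn iota2 rmorphN1.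
have sumZ : \sum_(i < n) zeta i ^+ 2 = \sum_(i < m.*2.+1) zeta i ^+ 2.
  rewrite -!(big_mkord xpredT (fun i => zeta i ^+ 2)).
  case: (odd n) nE => nE; first by rewrite [X in index_iota 0 X]nE.
  rewrite [X in index_iota 0 X]nE add0n big_nat_recr //=.
  rewrite [zeta m.*2](_ : _ = 0) ?expr0n ?addr0 //.
  by apply: big1 => p _; rewrite Zout ?rmorph0 ?mul0r // nE.
have normE : \sum_p g (d1 p.1 * d2 p.2) * segre x y p ^+ 2 = \sum_(i < n) zeta i ^+ 2.
  pose X (j : 'I_r) := \sum_c x c * g (orthogonal_vector iota d1 c j).
  pose Y (k : 'I_s) := \sum_c y c * g (orthogonal_vector iota d2 c k).
  transitivity ((\sum_(j < r) X j ^+ 2) * (\sum_(k < s) Y k ^+ 2)).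
    rewrite !norm_orthogonal_combination // big_distrlr pair_bigA /=.
    by apply: eq_bigr => p _; rewrite /segre rmorphM; ring.
  rewrite (evaluate_formula (g \o f) X Y formula); apply: eq_bigr => i _; congr (_ ^+ 2).
  rewrite /zeta /pairing; under [RHS]eq_bigr => p _ do
    rewrite /Z valK /= rmorph_sum mulr_suml.
  rewrite [RHS]exchange_big; apply: eq_bigr => j _ /=.
  under [RHS]eq_bigr => p _ do rewrite rmorph_sum mulr_suml.
  rewrite [RHS]exchange_big; apply: eq_bigr => k _ /=.
  rewrite /X /Y big_distrlr pair_bigA mulr_sumr; apply: eq_bigr => p _.
  by rewrite !rmorphM /segre /=; ring.
transitivity (\sum_p g (d1 p.1 * d2 p.2) * segre x y p ^+ 2 - zeta m.*2 ^+ 2).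
  rewrite -qform_diag expr2 {1}/zeta /pairing mulr_suml -sumrN -big_split.
  apply: eq_bigr => p _ /=; rewrite mulr_sumr -sumrN -big_split.
  apply: eq_bigr => q _ /=; rewrite rmorphB rmorphM /diag_form rmorphMn; ring.
rewrite normE sumZ (sum_of_squares_hyperbolic giota2) addrK; apply: eq_bigr => i _.
rewrite /zeta /pairing; congr (_ * _);
  rewrite mulr_sumr -?sumrN -big_split; apply: eq_bigr => p _ /=.
  by rewrite rmorphD rmorphM; ring.
by rewrite rmorphB rmorphM; ring.
Qed.

Theorem theorem1p2 (F : fieldType) (r s n : nat) :
  2%N \notin [pchar F] ->
  (0 < r)%N -> (0 < s)%N -> (0 < n)%N ->
  (exists z : 'I_n -> {mpoly F[r + s]}, sum_of_squares_formula z) ->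
  forall i : int, n%:Z - r%:Z < i -> i < s%:Z -> ~~ odd (binz n i).
Proof.
move=> char2 _ _ _ [z [bil formula]] [i|//] ni is_ /=; apply/negP => oddC.
have [c zE] := fin_all_exists bil.
have {formula}formula : (\sum_(j < r) xvar F s j ^+ 2) * (\sum_(k < s) yvar F r k ^+ 2)
    = \sum_(i < n) bilinear_expr (c i) ^+ 2.
  by rewrite formula; apply: eq_bigr => i' _; rewrite zE.
have nir : (n < i + r)%N by lia.
have lis : (i < s)%N by lia.
have lin : (i <= n)%N by rewrite leqNgt; apply: contraTN oddC => /bin_small->.
have [le_odd oddm] := odd_bin_half oddC.
have nE := esym (odd_double_half n); have iE := esym (odd_double_half i).
set b := i./2 in oddm iE; set m := n./2 in oddm nE.
have [a mE] : exists a, m = (b + a)%N.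
  by exists (m - b)%N; rewrite subnKC // leq_half_double; lia.
have [F1 [f1 [z1 z1E]]] := sqrt_minus_one F.
have [K [f2 [t aK]]] := generic_pfister F1 (a.+1 + b.+1).
have two : 2%:R != 0 :> K.
  rewrite -(rmorph_nat (f2 \o f1)) fmorph_eq0; apply: contra char2 => two0.
  by rewrite inE /=.
have iota2 : f2 z1 ^+ 2 = -1 by rewrite -rmorphXn z1E rmorphN1.
pose ea := (a.*2.+1 < r)%N; pose eb := (b.*2.+1 < s)%N.
pose d1 (c : 'I_a.+1) := \prod_(i in marker_l b ea c) t i.
pose d2 (c : 'I_b.+1) := \prod_(i in marker_r a eb c) t i.
(* n - i = 2a + (odd n - odd i), and i = 2b + odd i: for odd n, one of the two
   flags below is set. *)
have ar : (a.*2 + (odd n - odd i) < r)%N.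
  move: nir le_odd nE iE; rewrite mE doubleD.
  by move: (nat_of_bool (odd n)) (nat_of_bool (odd i)) => x y; lia.
have bs : (b.*2 + odd i < s)%N by rewrite addnC -iE.
have h1 (c' : 'I_a.+1) : (c'.*2 < r)%N /\ ((c'.*2.+1 < r)%N \/ d1 c' = 1).
  by apply: weight_condition; apply: leq_ltn_trans ar; apply: leq_addr.
have h2 (c' : 'I_b.+1) : (c'.*2 < s)%N /\ ((c'.*2.+1 < s)%N \/ d2 c' = 1).
  by apply: weight_condition; apply: leq_ltn_trans bs; apply: leq_addr.
have [U [V [W [UV W0]]]] := factors_formula (f2 \o f1) two iota2 nE h1 h2 formula.
have aB : anisotropic (fun p q => diag_form (fun p => d1 p.1 * d2 p.2) p q - W p * W q).
  apply: eq_anisotropic (anisotropic_markers (ea := ea) (eb := eb) (W := W) iota2 aK _).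
    by move=> p q; rewrite /diag_form prod_marker.
  have [on|en] := boolP (odd n); last by left; apply: W0.
  right; rewrite /ea /eb; move: ar bs; rewrite on; case: (odd i).
    by rewrite addn1 => _ ->; rewrite orbT.
  by rewrite subn0 addn1 => ->.
move: m mE U V UV oddm {nE ar} => m mE U V UV oddm; subst m.
by have := even_intersection two aB UV; rewrite oddm.
Qed.
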